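(* Let $d\ge 1$ be an integer. Given a graph $G$ on $n$ vertices with a weight function $w\colon V(G)\to\mathbb{R}$, together with a nice $k$-almost chordal tree decomposition of $G$ with $n^{\mathcal{O}(1)}$ bags, the \textsc{Weighted $d$-colorable Subgraph} problem can be solved in time $2^{\mathcal{O}(\sqrt{k}\cdot d\log d)}\cdot n^{\mathcal{O}(d)}$.
   Context: \textsc{Weighted $d$-colorable Subgraph}: given a graph $G$ with weight function $w\colon V(G)\to\mathbb{R}$, find a $d$-colorable induced subgraph $H$ of $G$ of maximum weight $\sum_{v\in V(H)}w(v)$. For a graph $H$, ${\sf c\mbox{-}comp}(H)$ is the number of non-adjacent pairs of distinct vertices of $H$. A tree decomposition of $G$ is a pair $(T,\{X_t\}_{t\in V(T)})$ where $T$ is a tree and $X_t\subseteq V(G)$ such that every vertex lies in some bag, every edge has both endpoints in some bag, and for each vertex the nodes whose bags contain it induce a connected subtree. It is $k$-almost chordal if ${\sf c\mbox{-}comp}(G[X_t])\le k$ for all $t$. It is nice if $T$ is rooted at $r$, $X_r=\emptyset$, leaves have empty bags, and every non-leaf node is an introduce node (one child $t'$, $X_t=X_{t'}\cup\{v\}$, $v\notin X_{t'}$), a forget node (one child $t'$, $X_t=X_{t'}\setminus\{w\}$, $w\in X_{t'}$), or a join node (two children with bags equal to $X_t$). *)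

(* Defs.v *)
From mathcomp Require Import all_boot all_order all_algebra.
From mathcomp Require Import reals exp.

Set Implicit Arguments.
Unset Strict Implicit.
Unset Printing Implicit Defensive.

Import Order.TTheory GRing.Theory Num.Theory.

Definition simple_graph (V : finType) (e : rel V) : Prop :=
  symmetric e /\ irreflexive e.

Section Graphs.
Variables (V T : finType).

(* An induced subgraph is represented by its vertex set. *)
Definition d_colorable (d : nat) (e : rel V) (S : {set V}) : Prop :=
  exists col : V -> nat,
    (forall v, v \in S -> col v < d) /\
    (forall u v, u \in S -> v \in S -> e u v -> col u <> col v).

(* c-comp of the subgraph induced by S, for e symmetric and irreflexive:
   non-adjacent pairs are unordered, hence counted as 2-element subsets. *)
Definition c_comp (e : rel V) (S : {set V}) : nat :=
  #|[set B : {set V} | [&& B \subset S, #|B| == 2 &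
       [forall u in B, forall v in B, ~~ e u v]]]|.

Definition is_tree (tr : rel T) : Prop :=
  [/\ simple_graph tr,
      0 < #|T|,
      forall x y, connect tr x y
    & forall p : seq T, cycle tr p -> uniq p -> size p <= 2].

Definition tree_decomposition (e : rel V) (tr : rel T) (X : T -> {set V}) : Prop :=
  [/\ is_tree tr,
      forall v, exists t, v \in X t,
      forall u v, e u v -> exists t, (u \in X t) /\ (v \in X t)
    & forall v t t', v \in X t -> v \in X t' ->
        connect [rel x y | [&& tr x y, v \in X x & v \in X y]] t t'].

Definition almost_chordal (k : nat) (e : rel V) (X : T -> {set V}) : Prop :=
  forall t, c_comp e (X t) <= k.

(* c is a child of t in the tree tr rooted at r: some simple path starting
   at r ends with the edge from t to c. *)
Definition child (tr : rel T) (r t c : T) : Prop :=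
  exists p : seq T,
    [/\ path tr r (rcons p c), uniq (r :: rcons p c) & last r p = t].

Definition leaf_node (tr : rel T) (r t : T) : Prop :=
  forall c, ~ child tr r t c.

Definition introduce_node (tr : rel T) (r : T) (X : T -> {set V}) (t : T) : Prop :=
  exists t' v, [/\ forall c, child tr r t c <-> c = t',
                   v \notin X t' & X t = v |: X t'].

Definition forget_node (tr : rel T) (r : T) (X : T -> {set V}) (t : T) : Prop :=
  exists t' w, [/\ forall c, child tr r t c <-> c = t',
                   w \in X t' & X t = X t' :\ w].

Definition join_node (tr : rel T) (r : T) (X : T -> {set V}) (t : T) : Prop :=
  exists t1 t2, [/\ t1 != t2,
                    forall c, child tr r t c <-> c = t1 \/ c = t2,
                    X t1 = X t & X t2 = X t].

Definition nice (tr : rel T) (r : T) (X : T -> {set V}) : Prop :=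
  [/\ X r = set0,
      forall t, leaf_node tr r t -> X t = set0
    & forall t, ~ leaf_node tr r t ->
        [\/ introduce_node tr r X t, forget_node tr r X t | join_node tr r X t]].

End Graphs.

Definition max_weight_d_colorable (R : realType) (V : finType) (d : nat)
    (e : rel V) (w : V -> R) (H : {set V}) : Prop :=
  d_colorable d e H /\
  forall S : {set V}, d_colorable d e S ->
    (\sum_(v in S) w v <= \sum_(v in H) w v)%R.

(* A unit-cost real RAM.  Memory consists of natural-number arrays and real arrays, each with
   countably many cells; a program mentions finitely many of them.  The only
   arithmetic on either sort is addition and subtraction (truncated on nat):
   there is no multiplication, rounding or conversion between the sorts, so that
   unit cost does not allow exponentially long integers to be built in polynomial
   time or information to be packed into reals. *)

Inductive iexp : Type :=
  | INum of nat
  | IGet of nat & iexp              (* array name, index *)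
  | IAdd of iexp & iexp
  | ISub of iexp & iexp.

Inductive rexp : Type :=
  | RZero
  | RGet of nat & iexp
  | RAdd of rexp & rexp
  | RSub of rexp & rexp.

Inductive test : Type :=
  | TLeI of iexp & iexp
  | TLeR of rexp & rexp
  | TNot of test
  | TAnd of test & test.

Inductive prog : Type :=
  | Skip
  | ISet of nat & iexp & iexp       (* array name, index, value *)
  | RSet of nat & iexp & rexp
  | Seq of prog & prog
  | If of test & prog & prog
  | While of test & prog.

Section Semantics.
Variable R : realType.

Record memory : Type := Memory {
  imem : nat -> nat -> nat;
  rmem : nat -> nat -> R
}.

Definition write (A : Type) (m : nat -> nat -> A) (a i : nat) (x : A) :
    nat -> nat -> A :=
  fun b j => if (b == a) && (j == i) then x else m b j.

Definition iwrite (s : memory) (a i x : nat) : memory :=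
  Memory (write (imem s) a i x) (rmem s).

Definition rwrite (s : memory) (a i : nat) (x : R) : memory :=
  Memory (imem s) (write (rmem s) a i x).

Fixpoint ieval (s : memory) (x : iexp) : nat :=
  match x with
  | INum m => m
  | IGet a i => imem s a (ieval s i)
  | IAdd x1 x2 => ieval s x1 + ieval s x2
  | ISub x1 x2 => ieval s x1 - ieval s x2
  end.

Fixpoint reval (s : memory) (x : rexp) : R :=
  match x with
  | RZero => 0%R
  | RGet a i => rmem s a (ieval s i)
  | RAdd x1 x2 => (reval s x1 + reval s x2)%R
  | RSub x1 x2 => (reval s x1 - reval s x2)%R
  end.

Fixpoint teval (s : memory) (b : test) : bool :=
  match b with
  | TLeI x1 x2 => ieval s x1 <= ieval s x2
  | TLeR x1 x2 => (reval s x1 <= reval s x2)%R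
  | TNot b1 => ~~ teval s b1
  | TAnd b1 b2 => teval s b1 && teval s b2
  end.

End Semantics.

Fixpoint icost (x : iexp) : nat :=
  match x with
  | INum _ => 1
  | IGet _ i => (icost i).+1
  | IAdd x1 x2 | ISub x1 x2 => (icost x1 + icost x2).+1
  end.

Fixpoint rcost (x : rexp) : nat :=
  match x with
  | RZero => 1
  | RGet _ i => (icost i).+1
  | RAdd x1 x2 | RSub x1 x2 => (rcost x1 + rcost x2).+1
  end.

Fixpoint tcost (b : test) : nat :=
  match b with
  | TLeI x1 x2 => (icost x1 + icost x2).+1
  | TLeR x1 x2 => (rcost x1 + rcost x2).+1
  | TNot b1 => (tcost b1).+1
  | TAnd b1 b2 => (tcost b1 + tcost b2).+1
  end.

(* [exec P s t s']: started in memory s, P halts after t steps in memory s'. *)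
Inductive exec (R : realType) : prog -> memory R -> nat -> memory R -> Prop :=
  | exec_skip s : exec Skip s 1 s
  | exec_iset s a i x :
      exec (ISet a i x) s (icost i + icost x).+1
           (iwrite s a (ieval s i) (ieval s x))
  | exec_rset s a i x :
      exec (RSet a i x) s (icost i + rcost x).+1
           (rwrite s a (ieval s i) (reval s x))
  | exec_seq P1 P2 s s1 s2 t1 t2 :
      exec P1 s t1 s1 -> exec P2 s1 t2 s2 ->
      exec (Seq P1 P2) s (t1 + t2) s2
  | exec_if b P1 P2 s s1 t :
      exec (if teval s b then P1 else P2) s t s1 ->
      exec (If b P1 P2) s (tcost b + t).+1 s1
  | exec_while_false b P s :
      ~~ teval s b -> exec (While b P) s (tcost b).+1 s
  | exec_while_true b P s s1 s2 t1 t2 :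
      teval s b -> exec P s t1 s1 -> exec (While b P) s1 t2 s2 ->
      exec (While b P) s (tcost b + t1 + t2).+1 s2.

Definition bit_matrix (m n : nat) (f : 'I_m -> 'I_n -> bool) (i : nat) : nat :=
  [exists x : 'I_m, exists y : 'I_n, (i == x * n + y) && f x y].

(* Integer array 0 holds the numbers n (vertices), N (tree nodes), d and the
   root; arrays 1, 2, 3 hold the adjacency matrix of the graph, the adjacency
   matrix of the tree and the node/vertex incidence matrix of the bags, all in
   row-major order; the answer is expected in integer array 4.  Real
   array 0 holds the weights.  All other cells are zero. *)
Definition input (R : realType) (n N d : nat) (e : rel 'I_n) (w : 'I_n -> R)
    (tr : rel 'I_N) (r : 'I_N) (X : 'I_N -> {set 'I_n}) : memory R :=
  Memory
    (fun a i => match a with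
      | 0 => nth 0 [:: n; N; d; nat_of_ord r] i
      | 1 => bit_matrix (fun u v => e u v) i
      | 2 => bit_matrix (fun t t' => tr t t') i
      | 3 => bit_matrix (fun t v => v \in X t) i
      | _ => 0
      end)
    (fun a i => match a with
      | 0 => if insub i is Some v then w v else 0%R
      | _ => 0%R
      end).

Definition output (R : realType) (n : nat) (s : memory R) : {set 'I_n} :=
  [set v : 'I_n | imem s 4 v != 0].

Definition log2 (R : realType) (x : R) : R := (ln x / ln 2)%R.

(* 2^(c * sqrt k * d log d) * n^(c * d).  The factor log d is read as
   max(1, log d): it differs from log d only for d = 1, where the bound would
   otherwise be polynomial in n for every k.  The base n is read as max(n, 2),
   as usual in asymptotic bounds; with this base constant factors are absorbed
   by the second factor. *)
Definition time_bound (R : realType) (c n d k : nat) : R :=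
  (2 `^ (c%:R * (Num.sqrt k%:R * (d%:R * Num.max 1 (log2 d%:R))))
   * (maxn n 2)%:R ^+ (c * d))%R.

(* Main.v *)
Require Import Defs.
From mathcomp Require Import all_boot all_order all_algebra.
From mathcomp Require Import reals exp.
From mathcomp Require Import zify.

(* A state of a node is a partial d-colouring of its bag.  If a graph has at most k
   non-adjacent pairs, some vertex has at most sqrt(2k) non-neighbours, so removing
   such vertices one by one shows that a bag has at most 1 + n 2^sqrt(2k)
   independent sets; a state is a d-tuple of these.  The nodes are listed in
   breadth-first order and eliminated from last to first, the value of each state
   of the parent being increased by that of the best compatible state of the node.
   As each vertex is weighed at the highest node containing it, what is left at the
   root, whose bag is empty, is the optimum, and a pass in the opposite direction
   recovers an optimal family of compatible states. *)

Set Implicit Arguments.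
Unset Strict Implicit.
Unset Printing Implicit Defensive.

Import Order.TTheory GRing.Theory Num.Theory.

Section IndependentSets.
Variables (V : finType) (e : rel V).
Hypothesis e_simple : simple_graph e.

Definition indep_sets (S : {set V}) : {set {set V}} :=
  [set A : {set V} | (A \subset S) && [forall u in A, forall v in A, ~~ e u v]].

Definition non_nbrs (S : {set V}) (v : V) : {set V} :=
  [set u in S | (u != v) && ~~ e v u].

Lemma sum_non_nbrs (S : {set V}) :
  \sum_(v in S) #|non_nbrs S v| <= 2 * c_comp e S.
Proof.
have [e_sym e_irr] := e_simple.
rewrite /c_comp; set C := [set B | _].
pose P := [set p : V * V | [&& p.1 \in S, p.2 \in S, p.2 != p.1 & ~~ e p.1 p.2]].
have -> : \sum_(v in S) #|non_nbrs S v| = #|P|.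
  transitivity (\sum_(v in S) \sum_(u in non_nbrs S v) 1).
    by apply: eq_bigr => v _; rewrite sum1_card.
  rewrite pair_big_dep /= sum1_card; apply: eq_card => -[u v].
  by rewrite unfold_in /= !inE.
have PC p : p \in P -> [set p.1; p.2] \in C.
  case: p => u v; rewrite !inE /= => /and4P[uS vS vu euv].
  rewrite cards2 (eq_sym u) vu subUset !sub1set uS vS /=.
  apply/forall_inP => x /set2P[]->; apply/forall_inP => y /set2P[]->;
    by rewrite ?e_irr // e_sym.
rewrite -sum1_card (partition_big (fun p : V * V => [set p.1; p.2]) (mem C)) //=.
rewrite mulnC -sum_nat_const; apply: leq_sum => B.
rewrite inE => /and3P[_ /cards2P[a [b [ab ->]]] _].
have {ab} two : #|[set (a, b); (b, a)]| = 2 by rewrite cards2 xpair_eqE negb_and ab.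
rewrite sum1_card -two; apply: subset_leq_card; apply/subsetP => -[u v].
rewrite unfold_in /= !inE /= => /andP[/and4P[_ _ vu _] /eqP uvab].
have : u \in [set a; b] by rewrite -uvab set21.
have : v \in [set a; b] by rewrite -uvab set22.
rewrite !inE !xpair_eqE; move: vu => /[swap] /orP[]/eqP-> /[swap] /orP[]/eqP->;
  by rewrite !eqxx ?orbT.
Qed.

Lemma card_indep_sets (k D : nat) (S : {set V}) :
  c_comp e S <= k -> 2 * k < D.+1 * D.+2 ->
  #|indep_sets S| <= 1 + #|S| * 2 ^ D.
Proof.
move=> ck kD; move: {2}#|S| (leqnn #|S|) => m.
elim: m S ck => [|m IHm] S ck Sm.
  have S0 : S = set0 by apply/eqP; rewrite -cards_eq0 -leqn0.
  rewrite S0 cards0 mul0n addn0 -(cards1 (set0 : {set V})).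
  by apply: subset_leq_card; apply/subsetP => A; rewrite !inE subset0 => /andP[].
have [->|[x xS]] := set_0Vmem S.
  rewrite cards0 mul0n addn0 -(cards1 (set0 : {set V})).
  by apply: subset_leq_card; apply/subsetP => A; rewrite !inE subset0 => /andP[].
have [v vS vD] : exists2 v, v \in S & #|non_nbrs S v| <= D.
  apply/exists_inP; apply: contraLR kD => /exists_inPn large.
  rewrite -leqNgt; apply: leq_trans (_ : 2 * c_comp e S <= _); last by rewrite leq_mul.
  apply: leq_trans (sum_non_nbrs S).
  apply: leq_trans (_ : \sum_(v in S) D.+1 <= _); last first.
    by apply: leq_sum => v /large; rewrite -ltnNge.
  rewrite sum_nat_const mulnC leq_mul // (cardsD1 x) xS ltnS.
  move: (large x xS); rewrite -ltnNge => /leq_trans; apply.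
  by apply: subset_leq_card; apply/subsetP => u; rewrite !inE => /and3P[-> ->].
have sub : indep_sets S \subset
    indep_sets (S :\ v) :|: [set v |: A | A in powerset (non_nbrs S v)].
  apply/subsetP => A; rewrite !inE => /andP[AS Ai].
  have [vA|vA] := boolP (v \in A); last by rewrite subsetD1 AS vA Ai.
  apply/orP; right; apply/imsetP; exists (A :\ v); last by rewrite setD1K.
  rewrite inE; apply/subsetP => u; rewrite !inE => /andP[-> uA].
  rewrite (subsetP AS) //=.
  by move/forall_inP: Ai => /(_ v vA) /forall_inP; apply.
apply: leq_trans (subset_leq_card sub) _; rewrite cardsU.
apply: leq_trans (leq_subr _ _) _.
have ckv : c_comp e (S :\ v) <= k.
  apply: leq_trans ck; apply: subset_leq_card; apply/subsetP => A.
  rewrite !inE => /and3P[AS -> ->].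
  by rewrite (subset_trans AS (subD1set _ _)).
have Sv : #|S| = #|S :\ v|.+1 by rewrite (cardsD1 v) vS.
have IH := IHm (S :\ v) ckv; rewrite -ltnS -Sv in IH.
apply: leq_trans (leq_add (IH Sm) (leq_imset_card _ _)) _.
rewrite card_powerset Sv mulSn (addnC (2 ^ D)) addnA leq_add2l.
by rewrite leq_exp2l.
Qed.

End IndependentSets.

Section Colorings.
Variables (n d : nat) (e : rel 'I_n) (B : {set 'I_n}).
Hypothesis e_simple : simple_graph e.

Definition coloring : Type := {ffun 'I_n -> nat}.

(* Colour [0] marks the vertices left out of the induced subgraph. *)
Definition valid (f : coloring) : bool :=
  [forall v, (f v != 0) ==> (v \in B) && (f v <= d)] &&
  [forall u, forall v, e u v && (f u == f v) ==> (f u == 0)].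

Definition upd (f : coloring) (v : 'I_n) (c : nat) : coloring :=
  [ffun u => if u == v then c else f u].

Definition free_color (f : coloring) (v : 'I_n) (c : nat) : bool :=
  [forall u, ~~ ((f u == c) && e u v)].

Definition extend (L : seq coloring) (v : 'I_n) (k : nat) : seq coloring :=
  [seq upd f v c.+1 | f <- L, c <- [seq c <- iota 0 k | free_color f v c.+1]].

Definition extensions (L : seq coloring) (v : 'I_n) : seq coloring :=
  if v \in B then L ++ extend L v d else L.

Fixpoint colorings (k : nat) : seq coloring :=
  if k is k'.+1 then
    oapp (extensions (colorings k')) (colorings k') (insub k')
  else [:: [ffun=> 0]].

Lemma coloringsS (v : 'I_n) :
  colorings v.+1 = extensions (colorings v) v.
Proof. by rewrite /= valK. Qed.

Lemma validP (f : coloring) :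
  reflect ((forall v, f v != 0 -> v \in B /\ f v <= d) /\
           (forall u v, e u v -> f u = f v -> f u = 0))
          (valid f).
Proof.
apply: (iffP andP) => -[fB fe]; split.
- by move=> v fv; apply/andP; move/forallP: fB => /(_ v) /implyP; apply.
- move=> u v uv fuv; apply/eqP; move/forallP: fe => /(_ u) /forallP/(_ v).
  by rewrite uv fuv eqxx.
- by apply/forallP => v; apply/implyP => /fB/andP.
- by apply/forallP => u; apply/forallP => v; apply/implyP => /andP[uv /eqP/(fe _ _ uv)->].
Qed.

Lemma extendP (L : seq coloring) (v : 'I_n) (k : nat) (g : coloring) :
  reflect (exists f c, [/\ f \in L, c < k, free_color f v c.+1 & g = upd f v c.+1])
          (g \in extend L v k).
Proof.
apply: (iffP allpairsPdep) => -[f [c]].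
  by rewrite mem_filter mem_iota add0n => -[fL /andP[fc ck] ->]; exists f, c.
by case=> fL ck fc ->; exists f, c; rewrite mem_filter mem_iota add0n fc.
Qed.

Definition supported (k : nat) (f : coloring) : bool :=
  [forall v : 'I_n, (k <= v) ==> (f v == 0)].

Lemma supportedP (k : nat) (f : coloring) :
  reflect (forall v : 'I_n, k <= v -> f v = 0) (supported k f).
Proof.
apply: (iffP forallP) => H v; first by move=> kv; apply/eqP/(implyP (H v)).
by apply/implyP => /H ->.
Qed.

Lemma mem_colorings (k : nat) (f : coloring) :
  k <= n -> (f \in colorings k) = valid f && supported k f.
Proof.
have [e_sym e_irr] := e_simple.
elim: k f => [|k IHk] f kn.
  rewrite inE; apply/eqP/andP => [->|[_ /supportedP f0]].
    by split; [apply/validP; split=> v; rewrite ?ffunE | apply/supportedP => v; rewrite ffunE].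
  by apply/ffunP => v; rewrite ffunE f0.
have IH g := IHk g (ltnW kn); pose v := Ordinal kn.
rewrite (coloringsS v) /extensions.
have supp_k g : supported k g = supported k.+1 g && (g v == 0).
  apply/supportedP/andP => [H|[/supportedP H /eqP gv] u].
    by rewrite (H v) //; split=> //; apply/supportedP => u /ltnW/H.
  rewrite leq_eqVlt => /orP[/eqP uv|/H //].
  by have -> : u = v by apply/val_inj.
case: (boolP (v \in B)) => [vB|vB]; last first.
  rewrite IH supp_k; case: (validP f) => //= -[fB _]; rewrite andbC.
  by case: eqP => // /eqP/fB[]; rewrite (negbTE vB).
rewrite mem_cat IH supp_k.
apply/orP/andP => [[/and3P[-> ->] //|]|[f_valid f_supp]].
  case/extendP => g [c [+ cd /forallP gc ->]].
  rewrite IH supp_k => /and3P[/validP[gB ge] /supportedP g_supp /eqP gv].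
  split; last first.
    apply/supportedP => u ku; rewrite ffunE; case: eqP => [uv|_]; last exact: g_supp.
    by rewrite uv ltnn in ku.
  apply/validP; split=> [u|u x]; rewrite !ffunE.
    by case: (u =P v) => [-> //|_ /gB].
  case: (u =P v) => [->|_]; case: (x =P v) => [->|_] //; first by rewrite e_irr.
    by move=> vx cx; move: (gc x); rewrite -cx e_sym vx eqxx.
  by move=> uv uc; move: (gc u); rewrite uc uv eqxx.
  exact: ge.
rewrite f_valid f_supp /=.
have [|fv] := eqVneq (f v) 0; [by left | right].
have /validP[fB fe] := f_valid; have [_ fvd] := fB v fv.
have fv1 : (f v).-1.+1 = f v by rewrite prednK // lt0n.
apply/extendP; exists (upd f v 0), (f v).-1; rewrite fv1 IH supp_k; split=> //.
- rewrite ffunE !eqxx andbT; apply/andP; split; last first.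
    by apply/supportedP => u ku; rewrite ffunE; case: eqP => // _; apply: (supportedP _ _ f_supp).
  apply/validP; split=> [u|u x]; rewrite !ffunE; first by case: (u =P v) => // _ /fB.
  by case: (u =P v); case: (x =P v) => // _ _; apply: fe.
- apply/forallP => u; rewrite ffunE; case: (u =P v) => [_|_]; first by rewrite eq_sym (negbTE fv).
  by apply/negP => /andP[/eqP fuv uv]; move: fv; rewrite -fuv (fe u v) ?eqxx.
- by apply/ffunP => u; rewrite !ffunE; case: eqP => [->|].
Qed.

Lemma colorings_uniq (k : nat) : k <= n -> uniq (colorings k).
Proof.
elim: k => [//|k IHk] kn; pose v := Ordinal kn.
have {}IHk := IHk (ltnW kn).
rewrite (coloringsS v) /extensions; case: ifP => // _.
have L0 f : f \in colorings k -> f v = 0.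
  by rewrite mem_colorings ?(ltnW kn) // => /andP[_ /supportedP]; apply.
rewrite cat_uniq IHk /=; apply/andP; split.
  apply/hasPn => f /extendP[g [c [_ _ _ ->]]]; apply/negP => /L0.
  by rewrite ffunE eqxx.
apply: allpairs_uniq_dep => //.
  by move=> f _; rewrite filter_uniq // iota_uniq.
move=> x y /allpairsPdep[f [c [fL _ ->]]] /allpairsPdep[f' [c' [fL' _ ->]]] /= E.
have fv u := congr1 (fun h : coloring => h u) E.
have -> : c = c' by move: (fv v); rewrite !ffunE eqxx => -[].
have -> // : f = f'.
apply/ffunP => u; move: (fv u); rewrite !ffunE.
by case: eqP => [->|//]; rewrite !L0.
Qed.

Lemma size_colorings (k D j : nat) :
  c_comp e B <= k -> 2 * k < D.+1 * D.+2 -> j <= n ->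
  size (colorings j) <= (1 + n * 2 ^ D) ^ d.
Proof.
move=> ck kD jn.
pose F (f : coloring) : {ffun 'I_d -> {set 'I_n}} :=
    [ffun c : 'I_d => [set v | f v == c.+1]].
have Finj : {in colorings j &, injective F}.
  move=> f g; rewrite !mem_colorings // => /andP[/validP[fB _] _] /andP[/validP[gB _] _] /ffunP E.
  have key (h h' : coloring) : (forall c, F h c = F h' c) ->
      (forall v, h v != 0 -> v \in B /\ h v <= d) -> forall v, h v != 0 -> h' v = h v.
    move=> hh hB v hv; have [_ hd] := hB v hv.
    case hE : (h v) hv hd => [//|c] _ cd.
    move/setP: (hh (Ordinal cd)) => /(_ v); rewrite !ffunE !inE hE eqxx /=.
    by move/esym/eqP.
  apply/ffunP => v.
  have [fv|/(key f g E fB) //] := eqVneq (f v) 0.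
  have [gv|/(key g f (fun c => esym (E c)) gB) //] := eqVneq (g v) 0.
  by rewrite fv gv.
rewrite -(size_map F); have /card_uniqP <- : uniq (map F (colorings j)).
  by rewrite map_inj_in_uniq // colorings_uniq.
apply: leq_trans (_ : #|@ffun_on 'I_d (indep_sets e B)| <= _).
  apply: subset_leq_card; apply/subsetP => _ /mapP[f + ->].
  rewrite mem_colorings // => /andP[/validP[fB fe] _].
  apply/ffun_onP => c; rewrite ffunE inE; apply/andP; split.
    by apply/subsetP => v; rewrite inE => /eqP fv; have [] := fB v; rewrite ?fv.
  apply/forall_inP => u; rewrite inE => /eqP fu; apply/forall_inP => v; rewrite inE => /eqP fv.
  by apply/negP => /fe; rewrite fu fv => /(_ erefl).
rewrite card_ffun_on card_ord; case: (d) => [//|d'].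
rewrite leq_exp2r //; apply: leq_trans (card_indep_sets e_simple ck kD) _.
rewrite leq_add2l leq_mul2r; apply/orP; right.
by apply: leq_trans (max_card _) _; rewrite card_ord.
Qed.

End Colorings.

Section RootedOrder.
Variables (V T : finType) (e : rel V) (tr : rel T) (X : T -> {set V}).
Hypothesis X_dec : tree_decomposition e tr X.
Variables (N : nat) (o : nat -> T) (par : nat -> nat).
Hypothesis o_inj : forall i j, i < N -> j < N -> o i = o j -> i = j.
Hypothesis o_surj : forall t, exists2 i, i < N & t = o i.
Hypothesis par0 : par 0 = 0.
Hypothesis par_lt : forall j, 0 < j -> j < N -> par j < j.
Hypothesis par_edge : forall j, 0 < j -> j < N -> tr (o (par j)) (o j).

(* A tree edge outside the parent relation would close a cycle with the path
   of parent edges joining its ends. *)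
Lemma tree_edge_par (i j : nat) :
  i < N -> j < N -> tr (o i) (o j) ->
  (0 < j /\ i = par j) \/ (0 < i /\ j = par i).
Proof.
move=> iN jN trij.
have [[[tr_sym tr_irr] _ _ acyclic] _ _ _] := X_dec.
pose pr := [rel x y | [exists l : 'I_N, (0 < l) &&
   ((x == o (par l)) && (y == o l) || (y == o (par l)) && (x == o l))]].
have prP x y : reflect (exists l, [/\ 0 < l, l < N &
    (x = o (par l) /\ y = o l) \/ (y = o (par l) /\ x = o l)]) (pr x y).
  apply: (iffP existsP) => [[l /andP[l0 /orP[]/andP[/eqP-> /eqP->]]]|[l [l0 lN H]]].
  - by exists l; split=> //; left.
  - by exists l; split=> //; right.
  - by exists (Ordinal lN); rewrite l0 /=; case: H => -[-> ->]; rewrite !eqxx ?orbT.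
have pr_tr x y : pr x y -> tr x y.
  by move=> /prP[l [l0 lN [[-> ->]|[-> ->]]]]; last rewrite tr_sym; apply: par_edge.
have pr_sym : symmetric pr.
  by move=> x y; apply/prP/prP => -[l [l0 lN [[]|[]]]]; exists l; split=> //; [right|left|right|left].
have to_root l : l < N -> connect pr (o l) (o 0).
  elim/ltn_ind: l => -[_ _|l IH lN]; first exact: connect0.
  have pl := par_lt (ltn0Sn l) lN.
  apply: connect_trans (IH _ pl (ltn_trans pl lN)); apply: connect1.
  by apply/prP; exists l.+1; split=> //; right.
have : connect pr (o j) (o i).
  by apply: connect_trans (to_root _ jN) _; rewrite (sym_connect_sym pr_sym) to_root.
case/connectP => p0 pr_p0 last_p0.
case/shortenP: pr_p0 last_p0 => p pr_p uniq_p _ last_p.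
have trp : cycle tr (o j :: p).
  by rewrite /= rcons_path -last_p trij andbT; apply: sub_path pr_p.
move: (acyclic _ trp uniq_p).
case: p pr_p uniq_p last_p {trp} => [|x [|y p]] //=.
  by move=> _ _ oij; rewrite oij tr_irr in trij.
rewrite andbT => /prP[l [l0 lN H]] _ xi _; rewrite -xi in H.
have plN := ltn_trans (par_lt l0 lN) lN.
case: H => -[/o_inj A /o_inj B].
- by right; rewrite B // A.
- by left; rewrite B // A.
Qed.

Lemma topmost (v : V) : exists m, [/\ m < N, v \in X (o m),
  0 < m -> v \notin X (o (par m)) &
  forall j, j < N -> v \in X (o j) -> j != m -> 0 < j /\ v \in X (o (par j))].
Proof.
have [_ cover _ conn] := X_dec.
have exP : exists m, (m < N) && (v \in X (o m)).
  by have [t vt] := cover v; have [m mN tE] := o_surj t; exists m; rewrite mN -tE.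
have parN j : j < N -> par j <= j.
  by case: j => [|j] jN; rewrite ?par0 // ltnW // par_lt.
case: (ex_minnP exP) => m /andP[mN vm] m_min; exists m; split=> //.
  move=> m0; apply/negP => vp; have pm := par_lt m0 mN.
  have := m_min (par m); rewrite vp (ltn_trans pm mN) => /(_ isT).
  by rewrite leqNgt pm.
move=> j jN vj jm; have mj : m <= j by apply: m_min; rewrite jN.
have j0 : 0 < j by move: jm mj; case: (j) => // /[swap]; rewrite leqn0 => /eqP->.
split=> //; apply: contraT => vp.
pose D x := exists2 i, i < N & x = o i /\ exists k, iter k par i = j.
have DE x y : tr x y -> v \in X y -> D x -> D y.
  move=> trxy vy [i iN [xi [k ik]]]; have [i' iN' yi'] := o_surj y.
  rewrite xi yi' in trxy; exists i' => //; split=> //.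
  have [[_ E]|[_ E]] := tree_edge_par iN iN' trxy.
    by exists k.+1; rewrite iterSr -E.
  case: k ik => [|k]; first by move=> /= ij; rewrite yi' E ij (negbTE vp) in vy.
  by rewrite iterSr -E => ik; exists k.
have : D (o m).
  have /connectP[p] := conn v _ _ vj vm.
  have : D (o j) by exists j => //; split=> //; exists 0.
  elim: p (o j) => [|y p IHp] x Dx /=; first by move=> _ ->.
  by case/andP => /and3P[xy _ vy] pth lst; apply: IHp pth lst; apply: DE Dx.
case=> i iN [/(o_inj mN iN) <- [k mk]].
suff : j <= m by rewrite leqNgt ltn_neqAle eq_sym jm mj.
rewrite -mk; elim: k {mk} => //= k IHk.
by apply: leq_trans (parN _ (leq_ltn_trans IHk mN)) IHk.
Qed.

End RootedOrder.

Section Elimination.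
Variables (R : realType) (n N d : nat) (e : rel 'I_n) (w : 'I_n -> R).
Variables (bag : nat -> {set 'I_n}) (par : nat -> nat).
Hypothesis e_simple : simple_graph e.
Hypothesis N_gt0 : 0 < N.
Hypothesis bag0 : bag 0 = set0.
Hypothesis par_lt : forall j, 0 < j -> j < N -> par j < j.
Hypothesis bag_edge : forall u v, e u v -> exists j, [/\ j < N, u \in bag j & v \in bag j].
Hypothesis bag_top : forall v, exists m, [/\ m < N, v \in bag m,
  0 < m -> v \notin bag (par m) &
  forall j, j < N -> v \in bag j -> j != m -> 0 < j /\ v \in bag (par j)].

Definition bag_colorings (j : nat) : seq (coloring n) := colorings d e (bag j) n.

Definition states (j : nat) : seq (nat * coloring n) :=
  [seq (i, f) | i <- iota 0 j, f <- bag_colorings i].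

Definition start (j : nat) : nat := size (states j).

Definition state (s : nat) : nat * coloring n := nth (0, [ffun=> 0]) (states N) s.

Definition state_of (j s : nat) : bool := (start j <= s) && (s < start j.+1).

(* A vertex is weighed only at the highest node whose bag contains it. *)
Definition own_weight (x : nat * coloring n) : R :=
  (\sum_(v | (x.2 v != 0) && (v \notin bag (par x.1))) w v)%R.

Definition compat (i f g : nat) : bool :=
  [forall v, (v \in bag i) && (v \in bag (par i)) ==> ((state f).2 v == (state g).2 v)].

Definition best (val : nat -> R) (i f b : nat) : Prop :=
  [/\ state_of i b, compat i f b &
      forall g, state_of i g -> compat i f g -> (val g <= val b)%R].

Definition elim_step (i : nat) (val val' : nat -> R) : Prop :=
  (forall f, state_of (par i) f -> exists2 b, best val i f b & val' f = (val f + val b)%R) /\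
  (forall f, f < start N -> ~~ state_of (par i) f -> val' f = val f).

Definition admissible (m : nat) (sg : nat -> nat) : Prop :=
  forall j, j < m -> state_of j (sg j) /\ (0 < j -> compat j (sg (par j)) (sg j)).

Definition total (sg : nat -> nat) : R := (\sum_(0 <= j < N) own_weight (state (sg j)))%R.

Definition elim_inv (m : nat) (val : nat -> R) : Prop :=
  (forall sg, admissible N sg -> (total sg <= \sum_(0 <= j < m) val (sg j))%R) /\
  (forall sg, admissible m sg ->
     (forall j, m <= j -> j < N -> best val j (sg (par j)) (sg j)) ->
     total sg = (\sum_(0 <= j < m) val (sg j))%R).

Lemma statesS (j : nat) :
  states j.+1 = states j ++ [seq (j, f) | f <- bag_colorings j].
Proof. by rewrite /states -[j.+1]addn1 iotaD map_cat flatten_cat /= cats0. Qed.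

Lemma startS (j : nat) : start j.+1 = start j + size (bag_colorings j).
Proof. by rewrite /start statesS size_cat size_map. Qed.

Lemma leq_start (i j : nat) : i <= j -> start i <= start j.
Proof.
by move=> /subnKC <-; elim: (j - i) => [|k IH]; rewrite ?addn0 // addnS startS (leq_trans IH) ?leq_addr.
Qed.

Lemma nth_states (i j s : nat) : i <= j -> s < start i ->
  nth (0, [ffun=> 0]) (states j) s = nth (0, [ffun=> 0]) (states i) s.
Proof.
move=> /subnKC <- si; elim: (j - i) => [|k IH]; rewrite ?addn0 // addnS statesS nth_cat IH.
by rewrite -/(start _) (leq_trans si) // leq_start ?leq_addr.
Qed.

Lemma state_ofE (j s : nat) : j < N -> state_of j s ->
  (state s).1 = j /\ (state s).2 \in bag_colorings j.
Proof.
move=> jN /andP[js sj]; rewrite /state (nth_states jN) // statesS nth_cat.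
rewrite -/(start j) ltnNge js /= (nth_map [ffun=> 0]); last by rewrite ltn_subLR // -startS.
by split=> //; rewrite mem_nth // ltn_subLR // -startS.
Qed.

Lemma state_of_ltN (j s : nat) : j < N -> state_of j s -> s < start N.
Proof. by move=> jN /andP[_ /leq_trans]; apply; apply: leq_start. Qed.

Lemma exists_state (j : nat) (f : coloring n) : j < N -> f \in bag_colorings j ->
  exists2 s, state_of j s & (state s).2 = f.
Proof.
move=> jN fj; pose s := start j + index f (bag_colorings j).
have sj : state_of j s by rewrite /state_of leq_addr startS ltn_add2l index_mem.
exists s => //; have /andP[js sj'] := sj.
rewrite /state (nth_states jN) // statesS nth_cat -/(start j) ltnNge js /=.
by rewrite addKn (nth_map [ffun=> 0]) ?index_mem // nth_index.
Qed.

Lemma state_of_inj (i j s : nat) : i < N -> j < N -> state_of i s -> state_of j s -> i = j.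
Proof. by move=> iN jN /(state_ofE iN)[<- _] /(state_ofE jN)[]. Qed.

Lemma state_valid (j s : nat) : j < N -> state_of j s ->
  (forall v, (state s).2 v != 0 -> v \in bag j /\ (state s).2 v <= d) /\
  (forall u v, e u v -> (state s).2 u = (state s).2 v -> (state s).2 u = 0).
Proof.
by move=> jN /(state_ofE jN)[_]; rewrite mem_colorings // => /andP[/validP].
Qed.

Lemma valid_state (j : nat) (f : coloring n) : j < N -> valid d e (bag j) f ->
  exists2 s, state_of j s & (state s).2 = f.
Proof.
move=> jN fv; apply: exists_state => //; rewrite mem_colorings // fv.
by apply/supportedP => v; rewrite leqNgt ltn_ord.
Qed.

Lemma exists_compat (i f : nat) : 0 < i -> i < N -> state_of (par i) f ->
  exists2 g, state_of i g & compat i f g.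
Proof.
move=> i0 iN fi; have pN := ltn_trans (par_lt i0 iN) iN.
have [fB fe] := state_valid pN fi.
pose h : coloring n := [ffun v => if v \in bag i then (state f).2 v else 0].
have [g gi gh] : exists2 g, state_of i g & (state g).2 = h.
  apply: valid_state => //; apply/validP; split=> [v|u v uv]; rewrite !ffunE.
    by case: ifP => // _ /fB[].
  by do 2!case: ifP => // _; apply: fe.
exists g => //; apply/forallP => v; apply/implyP => /andP[vi _].
by rewrite gh ffunE vi.
Qed.

Lemma sum_update (i p : nat) (F F' : nat -> R) (x : R) : p < i ->
  F' p = (F p + x)%R -> (forall j, j < i -> j != p -> F' j = F j) ->
  (\sum_(0 <= j < i) F' j = \sum_(0 <= j < i) F j + x)%R.
Proof.
move=> pi Fp Fj; rewrite !big_mkord (bigD1 (Ordinal pi)) //= Fp.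
rewrite [X in _ = (X + _)%R](bigD1 (Ordinal pi)) //= addrAC; congr (_ + _ + _)%R.
by apply: eq_bigr => j jp; apply: Fj.
Qed.

Lemma elim_inv_init (val : nat -> R) :
  (forall s, s < start N -> val s = own_weight (state s)) -> elim_inv N val.
Proof.
move=> valE; split=> [sg adm|sg adm _]; rewrite /total !big_mkord.
  by apply: ler_sum => j _; rewrite valE // (state_of_ltN _ (adm j _).1).
by apply: eq_bigr => j _; rewrite valE // (state_of_ltN _ (adm j _).1).
Qed.

Lemma elim_inv_step (i : nat) (val val' : nat -> R) : 0 < i -> i < N ->
  elim_inv i.+1 val -> elim_step i val val' -> elim_inv i val'.
Proof.
move=> i0 iN [upper attained] [stepP stepN].
have pi := par_lt i0 iN; have pN := ltn_trans pi iN.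
have val'E j s : j < N -> j != par i -> state_of j s -> val' s = val s.
  move=> jN jp js; apply: stepN; first exact: state_of_ltN js.
  by apply/negP => /(state_of_inj jN pN js) E; rewrite E eqxx in jp.
have sumE sg : (forall j, j < i -> state_of j (sg j)) -> exists2 b, best val i (sg (par i)) b &
    (\sum_(0 <= j < i) val' (sg j) = \sum_(0 <= j < i) val (sg j) + val b)%R.
  move=> adm; have [b bb val'p] := stepP _ (adm _ pi); exists b => //.
  apply: (sum_update pi val'p) => j ji jp.
  exact: val'E (ltn_trans ji iN) jp (adm _ ji).
split=> [sg adm|sg adm opt].
  apply: le_trans (upper sg adm) _.
  have [|b [bi bc bmax] ->] := sumE sg.
    by move=> j ji; have [] := adm j (ltn_trans ji iN).
  rewrite big_nat_recr //= lerD2l; apply: bmax; first by have [] := adm i iN.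
  by apply: (adm i iN).2.
have best_val j : i <= j -> j < N -> best val j (sg (par j)) (sg j).
  move=> ij jN; have [sj cj mj] := opt j ij jN; split=> // g gj gc.
  have jp : j != par i by rewrite gtn_eqF // (leq_trans pi).
  by rewrite -!(val'E j) // mj.
have [|b [bi bc bmax] ->] := sumE sg; first by move=> j /adm[].
have [si ci mi] := best_val i (leqnn i) iN.
rewrite attained.
- rewrite big_nat_recr //=; congr (_ + _)%R.
  by apply/eqP; rewrite eq_le bmax // mi.
- by move=> j; rewrite ltnS leq_eqVlt => /orP[/eqP->|/adm //]; split.
- by move=> j ij; apply: best_val; apply: ltnW.
Qed.

Definition selected (sg : nat -> nat) : {set 'I_n} :=
  [set v | [exists j : 'I_N, (state (sg j)).2 v != 0]].

Lemma admissible_agree (sg : nat -> nat) (v : 'I_n) : admissible N sg ->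
  exists m, [/\ 0 < m, m < N, v \in bag m, v \notin bag (par m) &
    forall j, j < N -> v \in bag j ->
      (state (sg j)).2 v = (state (sg m)).2 v /\ (j != m -> v \in bag (par j))].
Proof.
move=> adm; have [m [mN vm vp top]] := bag_top v.
have m0 : 0 < m by case: m vm {mN vp top} => //; rewrite bag0 inE.
exists m; split=> //; first exact: vp.
elim/ltn_ind => j IH jN vj; have [->//|jm] := eqVneq j m.
have [j0 vpj] := top j jN vj jm; split=> //.
have pj := par_lt j0 jN; have [<- _] := IH _ pj (ltn_trans pj jN) vpj.
have [_ /(_ j0)/forallP/(_ v)] := adm j jN.
by rewrite vj vpj => /eqP.
Qed.

Lemma selectedP (sg : nat -> nat) (v : 'I_n) (j : nat) : admissible N sg -> j < N ->
  v \in bag j -> (v \in selected sg) = ((state (sg j)).2 v != 0).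
Proof.
move=> adm jN vj; have [m [_ mN _ _ agree]] := admissible_agree v adm.
have [-> _] := agree j jN vj; rewrite inE.
apply/existsP/idP => [[i vi]|vm]; last by exists (Ordinal mN).
have [vB _] := state_valid (ltn_ord i) (adm i (ltn_ord i)).1.
by have [<- _] := agree i (ltn_ord i) (vB v vi).1.
Qed.

Lemma total_selected (sg : nat -> nat) : admissible N sg ->
  total sg = (\sum_(v in selected sg) w v)%R.
Proof.
move=> adm; rewrite /total big_mkord /own_weight.
rewrite (exchange_big_dep xpredT) //= [RHS]big_mkcond /=; apply: eq_bigr => v _.
have [m [m0 mN vm vp agree]] := admissible_agree v adm.
rewrite (selectedP adm mN vm).
have stE (j : 'I_N) : (state (sg j)).1 = j by have [] := state_ofE (ltn_ord j) (adm j (ltn_ord j)).1.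
rewrite (eq_bigl (fun j : 'I_N => (j == Ordinal mN) && ((state (sg m)).2 v != 0))).
  case: (_ != 0); last by rewrite big_pred0 // => j; rewrite andbF.
  by rewrite (eq_bigl (pred1 (Ordinal mN))) ?big_pred1_eq // => j; rewrite andbT.
move=> j; rewrite stE; apply/andP/andP => -[].
  move=> vj vpj; have [vB _] := state_valid (ltn_ord j) (adm j (ltn_ord j)).1.
  have [<- jm] := agree j (ltn_ord j) (vB v vj).1; split=> //.
  by apply: contraR vpj => ne; apply: jm; apply: contraNneq ne => E; apply/eqP/val_inj.
by move=> /eqP -> /=; split.
Qed.

Lemma elim_optimal (val : nat -> R) (sg : nat -> nat) :
  elim_inv 1 val -> sg 0 = 0 ->
  (forall j, 0 < j -> j < N -> best val j (sg (par j)) (sg j)) ->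
  max_weight_d_colorable d e w (selected sg).
Proof.
move=> [upper attained] sg0 opt.
have only0 s : state_of 0 s -> s = 0.
  rewrite /state_of startS /start /= add0n; suff -> : size (bag_colorings 0) = 1.
    by rewrite ltnS leqn0 => /eqP.
  have -> : bag_colorings 0 = [:: [ffun=> 0]]; last by [].
  rewrite /bag_colorings bag0; elim: (X in colorings _ _ _ X) => //= k ->.
  by case: insub => //= v; rewrite /extensions inE.
have st00 : state_of 0 0.
  have f0 : [ffun=> 0] \in bag_colorings 0.
    rewrite mem_colorings //; apply/andP; split; last by apply/supportedP => v; rewrite ffunE.
    by apply/validP; split=> [v|u v]; rewrite ffunE.
  by have [s ss _] := exists_state N_gt0 f0; move: (ss); rewrite (only0 s ss).
have adm1 : admissible 1 sg by case=> // _; rewrite sg0; split.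
have adm : admissible N sg.
  by case=> [|j] jN; [apply: adm1 | have [] := opt j.+1 (ltn0Sn j) jN].
have optE := attained sg adm1 opt.
split.
  have ex_top v : exists j, (j < N) && (v \in bag j).
    by have [j [jN vj _ _]] := bag_top v; exists j; rewrite jN.
  pose top v := ex_minn (ex_top v).
  have topP v : (top v < N) && (v \in bag (top v)) by rewrite /top; case: ex_minnP.
  pose c v := (state (sg (top v))).2 v.
  have cE v j : j < N -> v \in bag j -> c v = (state (sg j)).2 v.
    move=> jN vj; have [m [_ mN _ _ agree]] := admissible_agree v adm.
    have /andP[tN vt] := topP v.
    by have [E _] := agree _ tN vt; have [E' _] := agree _ jN vj; rewrite /c E E'.
  have cS v : v \in selected sg -> c v != 0.
    by have /andP[tN vt] := topP v; rewrite (selectedP adm tN vt).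
  exists (fun v => (c v).-1); split=> [v /cS cv|u v /cS cu /cS cv uv E].
    rewrite prednK ?lt0n //; have /andP[tN vt] := topP v.
    by have [vB _] := state_valid tN (adm _ tN).1; have [] := vB v cv.
  have [j [jN uj vj]] := bag_edge uv.
  have [_ je] := state_valid jN (adm _ jN).1.
  have cuv : c u = c v by rewrite -(prednK (n := c u)) ?lt0n // E prednK ?lt0n.
  move: (cu); rewrite (cE u j) // (je u v uv) ?eqxx //.
  by rewrite -!cE.
move=> S [col [col_lt col_ne]].
pose h j : coloring n := [ffun v => if (v \in S) && (v \in bag j) then (col v).+1 else 0].
have hv j : j < N -> exists s, state_of j s && ((state s).2 == h j).
  move=> jN; have [|s sj sE] := @valid_state j (h j) jN; last by exists s; rewrite sj sE /=.
  apply/validP; split=> [v|u v uv]; rewrite !ffunE.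
    by case: ifP => // /andP[/col_lt ? ->].
  case: ifP => // /andP[uS _]; case: ifP => // /andP[vS _] [E].
  by case: (col_ne u v uS vS uv).
pose tau j := if @idP (j < N) is ReflectT jN then xchoose (hv j jN) else 0.
have tauP j : j < N -> state_of j (tau j) /\ (state (tau j)).2 = h j.
  by move=> jN; rewrite /tau; case: {-}_ / idP => // jN'; have /andP[? /eqP] := xchooseP (hv j jN').
have adm_tau : admissible N tau.
  move=> j jN; have [tj tE] := tauP j jN; split=> // j0.
  have [_ tpE] := tauP (par j) (ltn_trans (par_lt j0 jN) jN).
  apply/forallP => v; apply/implyP => /andP[vj vp].
  by rewrite tE tpE !ffunE vj vp.
have -> : S = selected tau.
  apply/setP => v; have [m [mN vm _ _]] := bag_top v.
  rewrite (selectedP adm_tau mN vm); have [_ ->] := tauP m mN.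
  by rewrite ffunE vm andbT; case: (v \in S).
rewrite -!total_selected // optE; apply: le_trans (upper tau adm_tau) _.
rewrite !big_nat1 sg0; have [/only0 -> _] := tauP 0 N_gt0; exact: lexx.
Qed.

End Elimination.

Section Execution.
Variable R : realType.
Implicit Types (P : prog) (s : memory R) (Q : memory R -> Prop).

Fixpoint imods P : seq nat :=
  match P with
  | ISet a _ _ => [:: a]
  | Seq P1 P2 | If _ P1 P2 => imods P1 ++ imods P2
  | While _ P1 => imods P1
  | _ => [::]
  end.

Fixpoint rmods P : seq nat :=
  match P with
  | RSet a _ _ => [:: a]
  | Seq P1 P2 | If _ P1 P2 => rmods P1 ++ rmods P2
  | While _ P1 => rmods P1
  | _ => [::]
  end.

Definition same P s s' : Prop :=
  (forall a, a \notin imods P -> imem s' a = imem s a) /\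
  (forall a, a \notin rmods P -> rmem s' a = rmem s a).

Lemma exec_same P s t s' : exec P s t s' -> same P s s'.
Proof.
elim=> {P s t s'} //=.
- move=> s a i x; split=> //= b; rewrite inE /write => /negbTE ba.
  by rewrite ba.
- move=> s a i x; split=> //= b; rewrite inE /write => /negbTE ba.
  by rewrite ba.
- move=> P1 P2 s s1 s2 t1 t2 _ [i1 r1] _ [i2 r2].
  by split=> a /=; rewrite mem_cat negb_or => /andP[a1 a2]; rewrite ?i2 ?i1 ?r2 ?r1.
- move=> b P1 P2 s s1 t _; case: ifP => _ [i1 r1];
    by split=> a /=; rewrite mem_cat negb_or => /andP[a1 a2]; rewrite ?i1 ?r1.
- move=> b P s s1 s2 t1 t2 _ _ [i1 r1] _ [i2 r2].
  by split=> a a1; rewrite ?i2 ?i1 ?r2 ?r1.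
Qed.

(* An upper bound for the running time when no loop runs more than [M] times. *)
Fixpoint cost (M : nat) P : nat :=
  match P with
  | Skip => 1
  | ISet _ i x => (icost i + icost x).+1
  | RSet _ i x => (icost i + rcost x).+1
  | Seq P1 P2 => cost M P1 + cost M P2
  | If b P1 P2 => (tcost b + (cost M P1 + cost M P2)).+1
  | While b P1 => M * (tcost b + cost M P1).+1 + (tcost b).+1
  end.

Lemma cost_poly P : exists K p, forall M, 0 < M -> cost M P <= K * M ^ p.
Proof.
have le_poly K p M : 0 < M -> K <= K * M ^ p by move=> M0; rewrite leq_pmulr // expn_gt0 M0.
have grow K p q M : 0 < M -> K * M ^ p <= K * M ^ (p + q).
  by move=> M0; rewrite leq_mul2l leq_pexp2l ?leq_addr ?orbT.
elim: P => [|a i x|a i x|P1 [K1 [p1 H1]] P2 [K2 [p2 H2]]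
           |b P1 [K1 [p1 H1]] P2 [K2 [p2 H2]]|b P1 [K1 [p1 H1]]].
- by exists 1, 0.
- by exists (icost i + icost x).+1, 0 => M M0; apply: le_poly.
- by exists (icost i + rcost x).+1, 0 => M M0; apply: le_poly.
- exists (K1 + K2), (p1 + p2) => M M0; rewrite /= mulnDl leq_add //.
    exact: leq_trans (H1 M M0) (grow _ _ _ _ M0).
  by rewrite addnC; apply: leq_trans (H2 M M0) (grow _ _ _ _ M0).
- exists ((tcost b).+1 + (K1 + K2)), (p1 + p2) => M M0.
  rewrite /= -addSn 2!mulnDl leq_add ?le_poly // leq_add //.
    exact: leq_trans (H1 M M0) (grow _ _ _ _ M0).
  by rewrite addnC; apply: leq_trans (H2 M M0) (grow _ _ _ _ M0).
- exists ((tcost b).+1 + K1 + (tcost b).+1), p1.+1 => M M0.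
  rewrite /= mulnDl leq_add ?le_poly // expnSr mulnA (mulnC M) leq_mul2r.
  by rewrite -addSn mulnDl leq_add ?le_poly ?H1 ?orbT.
Qed.

Definition wp (M : nat) P s Q : Prop :=
  exists t s', [/\ exec P s t s', t <= cost M P & Q s'].

Variable M : nat.

Lemma wp_use P s Q' Q :
  wp M P s Q' -> (forall s', same P s s' -> Q' s' -> Q s') -> wp M P s Q.
Proof.
by move=> [t [s' [ex tM Qs']]] QQ; exists t, s'; split=> //; apply: QQ (exec_same ex) Qs'.
Qed.

Lemma wp_skip s Q : Q s -> wp M Skip s Q.
Proof. by move=> Qs; exists 1, s; split=> //; constructor. Qed.

Lemma wp_iset a i x s Q :
  Q (iwrite s a (ieval s i) (ieval s x)) -> wp M (ISet a i x) s Q.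
Proof. by move=> Qs; eexists _, _; split; [constructor | | exact: Qs]. Qed.

Lemma wp_rset a i x s Q :
  Q (rwrite s a (ieval s i) (reval s x)) -> wp M (RSet a i x) s Q.
Proof. by move=> Qs; eexists _, _; split; [constructor | | exact: Qs]. Qed.

Lemma wp_seq P1 P2 s Q :
  wp M P1 s (fun s1 => wp M P2 s1 Q) -> wp M (Seq P1 P2) s Q.
Proof.
move=> [t1 [s1 [ex1 c1 [t2 [s2 [ex2 c2 Qs]]]]]]; exists (t1 + t2), s2.
by split=> //; [apply: exec_seq ex1 ex2 | apply: leq_add].
Qed.

Lemma wp_if b P1 P2 s Q :
  (teval s b -> wp M P1 s Q) -> (~~ teval s b -> wp M P2 s Q) -> wp M (If b P1 P2) s Q.
Proof.
move=> H1 H2; have [t [s1 [ex tM Qs]]] : exists t s1,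
    [/\ exec (if teval s b then P1 else P2) s t s1, t <= cost M P1 + cost M P2 & Q s1].
  case: ifP => [/H1|/negbT/H2] [t [s1 [ex tM Qs]]]; exists t, s1; split=> //;
    apply: leq_trans tM _; by rewrite ?leq_addr ?leq_addl.
exists (tcost b + t).+1, s1; split=> //; first exact: exec_if.
by rewrite /= ltnS leq_add2l.
Qed.

Definition for_loop (i : nat) (lo hi : iexp) P : prog :=
  Seq (ISet i (INum 1) hi) (Seq (ISet i (INum 0) lo)
    (While (TLeI (IAdd (IGet i (INum 0)) (INum 1)) (IGet i (INum 1)))
       (Seq P (ISet i (INum 0) (IAdd (IGet i (INum 0)) (INum 1)))))).

Lemma wp_for (inv : nat -> memory R -> Prop) (L H i : nat) (lo hi : iexp) P s Q :
  i \notin imods P ->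
  ieval s hi = H -> (forall x, ieval (iwrite s i 1 x) lo = L) ->
  L <= H -> H - L <= M ->
  (forall j s' x y, inv j s' -> inv j (iwrite s' i x y)) ->
  inv L s ->
  (forall j s', L <= j -> j < H -> same (for_loop i lo hi P) s s' ->
     imem s' i 0 = j -> inv j s' -> wp M P s' (inv j.+1)) ->
  (forall s', same (for_loop i lo hi P) s s' -> inv H s' -> Q s') ->
  wp M (for_loop i lo hi P) s Q.
Proof.
move=> iP hiE loE LH HLM invI invL body post; apply: wp_seq; apply: wp_iset.
rewrite hiE /=; apply: wp_seq; apply: wp_iset; rewrite loE.
set s0 := iwrite _ _ _ _; set W := While _ _.
pose C := (tcost (TLeI (IAdd (IGet i (INum 0)) (INum 1)) (IGet i (INum 1))) +
   cost M (Seq P (ISet i (INum 0) (IAdd (IGet i (INum 0)) (INum 1))))).+1.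
pose c := (tcost (TLeI (IAdd (IGet i (INum 0)) (INum 1)) (IGet i (INum 1)))).+1.
have run k : forall j s1, L <= j -> j + k = H -> same (for_loop i lo hi P) s s1 ->
    imem s1 i 0 = j -> imem s1 i 1 = H -> inv j s1 ->
    exists t s', [/\ exec W s1 t s', t <= k * C + c & same (for_loop i lo hi P) s s' /\ inv H s'].
  elim: k => [|k IHk] j s1 Lj jk sm i0 i1 invj.
    exists c, s1; rewrite mul0n add0n; split=> //; last by rewrite -jk addn0.
    by apply: exec_while_false; rewrite /= i0 i1 -jk addn0 addn1 ltnn.
  have jH : j < H by rewrite -jk addnS ltnS leq_addr.
  have [t1 [s2 [ex1 c1 inv2]]] := body j s1 Lj jH sm i0 invj.
  have sm2 := exec_same ex1.
  pose s3 := iwrite s2 i 0 (imem s2 i 0 + 1).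
  have [] := IHk j.+1 s3.
  - exact: leqW.
  - by rewrite addSn -addnS.
  - split=> a am; last first.
      rewrite /= sm2.2; first exact: sm.2.
      by move: am; rewrite /= cats0.
    have ai : (a == i) = false by apply: contraNF am => /eqP ->; rewrite /= inE eqxx.
    rewrite /= /write ai /= sm2.1; first by rewrite -(sm.1 a am).
    by apply: contra am; rewrite /= !inE mem_cat => ->; rewrite !orbT.
  - by rewrite /= /write !eqxx /= sm2.1 // i0 addn1.
  - by rewrite /= /write eqxx /= sm2.1.
  - exact: invI.
  move=> t2 [s' [ex2 c2 post2]]; eexists _, s'; split; last exact: post2.
    apply: exec_while_true ex2; first by rewrite /= i0 i1 addn1.
    by apply: exec_seq ex1 _; constructor.
  move: c1 c2; rewrite /C /c /=; lia.
have same0 : same (for_loop i lo hi P) s s0.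
  split=> // a; rewrite /= inE negb_or => /andP[/negbTE ai _].
  by rewrite /= /write ai.
have [] := run (H - L) L s0.
- by [].
- exact: subnKC.
- exact: same0.
- by rewrite /= /write !eqxx.
- by rewrite /= /write eqxx.
- by do 2!apply: (invI).
move=> t [s' [ex tc [sm invH]]]; exists t, s'; split; [by [] | | exact: post].
apply: leq_trans tc _; rewrite /= -/c leq_add // leq_mul // /C /=; lia.
Qed.

End Execution.

(* Memory layout: arrays 5 and 6 hold the multiples of n and N; 7 and 9 the order
   of the nodes and the position of the parent; 8 and 10 the visited nodes and
   their number.  State s is the row of array 11 that starts at cell s of array
   14, its value is cell s of real array 1; cell 13 counts the states and array 12
   holds the first state of each position.  Array 17 holds the chosen states, and
   15, 16, 20-24 are flags, search results and loop variables. *)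
Definition var (a : nat) : iexp := IGet a (INum 0).
Definition positive (x : iexp) : test := TLeI (INum 1) x.
Definition equal (x y : iexp) : test := TAnd (TLeI x y) (TLeI y x).

Definition size_n : iexp := IGet 0 (INum 0).
Definition size_N : iexp := IGet 0 (INum 1).
Definition size_d : iexp := IGet 0 (INum 2).
Definition root : iexp := IGet 0 (INum 3).
Definition adjacent (u v : iexp) : iexp := IGet 1 (IAdd (IGet 5 u) v).
Definition tree_adjacent (t t' : iexp) : iexp := IGet 2 (IAdd (IGet 6 t) t').
Definition in_bag (j v : iexp) : iexp := IGet 3 (IAdd (IGet 5 (IGet 7 j)) v).
Definition color (s v : iexp) : iexp := IGet 11 (IAdd (IGet 14 s) v).

Definition make_tables : prog :=
  Seq
    (for_loop 20 (INum 0) (IAdd size_n size_N)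
      (ISet 5 (IAdd (var 20) (INum 1)) (IAdd (IGet 5 (var 20)) size_n)))
    (for_loop 20 (INum 0) size_N
      (ISet 6 (IAdd (var 20) (INum 1)) (IAdd (IGet 6 (var 20)) size_N))).

Definition order_nodes : prog :=
  Seq (ISet 7 (INum 0) root)
  (Seq (ISet 8 root (INum 1))
  (Seq (ISet 10 (INum 0) (INum 1))
    (for_loop 20 (INum 0) size_N
      (for_loop 21 (INum 0) size_N
        (If (TAnd (positive (tree_adjacent (IGet 7 (var 20)) (var 21)))
                  (TNot (positive (IGet 8 (var 21)))))
          (Seq (ISet 8 (var 21) (INum 1))
          (Seq (ISet 7 (var 10) (var 21))
          (Seq (ISet 9 (var 10) (var 20))
               (ISet 10 (INum 0) (IAdd (var 10) (INum 1))))))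
          Skip))))).

Section Program.
Variables (R : realType) (n N d : nat) (e : rel 'I_n) (w : 'I_n -> R).
Variables (tr : rel 'I_N) (r : 'I_N) (X : 'I_N -> {set 'I_n}) (M : nat).
Implicit Types s : memory R.

Record inputs s : Prop := Inputs {
  in_n : imem s 0 0 = n;
  in_N : imem s 0 1 = N;
  in_d : imem s 0 2 = d;
  in_r : imem s 0 3 = r;
  in_e : forall u v : 'I_n, imem s 1 (u * n + v) = e u v;
  in_tr : forall t t' : 'I_N, imem s 2 (t * N + t') = tr t t';
  in_X : forall (t : 'I_N) (v : 'I_n), imem s 3 (t * n + v) = (v \in X t);
  in_w : forall v : 'I_n, rmem s 0 v = w v }.

Definition tables s : Prop :=
  (forall i, i <= n + N -> imem s 5 i = i * n) /\ (forall i, i <= N -> imem s 6 i = i * N).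

Lemma inputs_same P s s' : same P s s' ->
  all (fun a => a \notin imods P) [:: 0; 1; 2; 3] -> 0 \notin rmods P ->
  inputs s -> inputs s'.
Proof.
move=> [si sr] /and5P[a0 a1 a2 a3 _] r0 [*].
by split=> *; rewrite ?(si 0) ?(si 1) ?(si 2) ?(si 3) ?sr.
Qed.

Lemma wp_make_tables s : n + N <= M -> inputs s -> imem s 5 0 = 0 -> imem s 6 0 = 0 ->
  wp M make_tables s (fun s' => inputs s' /\ tables s').
Proof.
move=> nNM ins z5 z6; apply: wp_seq.
apply: (wp_for (L := 0) (H := n + N)
  (inv := fun j s' => forall i, i <= j -> imem s' 5 i = i * n)) => //.
- by rewrite /= (in_n ins) (in_N ins).
- by rewrite subn0.
- by move=> i; rewrite leqn0 => /eqP ->.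
- move=> j s1 _ jH sm s20 inv; apply: wp_iset => i.
  rewrite /= /write /= s20 addn1 (sm.1 0 isT) (in_n ins) leq_eqVlt.
  by case: eqP => [-> _|_ /inv //]; rewrite inv // mulSn addnC.
move=> s1 sm1 tab5; have ins1 := inputs_same sm1 isT isT ins.
apply: (wp_for (L := 0) (H := N)
  (inv := fun j s' => forall i, i <= j -> imem s' 6 i = i * N)) => //.
- by rewrite /= (in_N ins1).
- by rewrite subn0; apply: leq_trans nNM; apply: leq_addl.
- by move=> i; rewrite leqn0 => /eqP ->; rewrite (sm1.1 6 isT).
- move=> j s2 _ jH sm s20 inv; apply: wp_iset => i.
  rewrite /= /write /= s20 addn1 (sm.1 0 isT) (in_N ins1) leq_eqVlt.
  by case: eqP => [-> _|_ /inv //]; rewrite inv // mulSn addnC.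
move=> s2 sm2 tab6; split; first exact: inputs_same sm2 isT isT ins1.
by split=> // i; rewrite (sm2.1 5 isT); apply: tab5.
Qed.

Record ordered (o : nat -> 'I_N) (par : nat -> nat) s : Prop := Ordered {
  order_o : forall j, j < N -> imem s 7 j = o j;
  order_par : forall j, j < N -> imem s 9 j = par j }.

Record visited (q : seq 'I_N) (i y : nat) s : Prop := Visited {
  vis_uniq : uniq q;
  vis_size : imem s 10 0 = size q;
  vis_nth : forall j, j < size q -> imem s 7 j = nth r q j;
  vis_mem : forall x : 'I_N, imem s 8 x = (x \in q);
  vis_par : forall j, 0 < j -> j < size q ->
    imem s 9 j < j /\ tr (nth r q (imem s 9 j)) (nth r q j);
  vis_par0 : imem s 9 0 = 0;
  vis_head : 0 < size q /\ nth r q 0 = r;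
  vis_le : i <= size q;
  vis_done : forall j x, j < i -> tr (nth r q j) x -> x \in q;
  vis_cur : forall x : 'I_N, x < y -> tr (nth r q i) x -> x \in q }.

Lemma visited_all (q : seq 'I_N) (i y : nat) s :
  (forall x z, connect tr x z) -> visited q i y s -> size q = i -> i = N.
Proof.
move=> conn vis qi; have [q0 qr] := vis_head vis.
have all_q x : x \in q.
  have /connectP[p] := conn r x; have : r \in q by rewrite -qr mem_nth.
  elim: p (r) => [|z p IHp] t tq /=; first by move=> _ ->.
  case/andP => tz pth lst; apply: IHp pth lst.
  by apply: (vis_done vis) (_ : index t q < i) _; rewrite -?qi ?index_mem ?nth_index.
rewrite -qi -(card_uniqP (vis_uniq vis)); apply: etrans (card_ord N).
by apply: eq_card => x; rewrite all_q.
Qed.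

Lemma wp_order_nodes s : N <= M -> is_tree tr -> inputs s -> tables s ->
  (forall x, imem s 8 x = 0) -> imem s 9 0 = 0 ->
  wp M order_nodes s (fun s' => exists o par, ordered o par s' /\
    [/\ forall i j, i < N -> j < N -> o i = o j -> i = j,
        forall t, exists2 i, i < N & t = o i,
        o 0 = r /\ par 0 = 0,
        forall j, 0 < j -> j < N -> par j < j
      & forall j, 0 < j -> j < N -> tr (o (par j)) (o j)]).
Proof.
move=> NM [_ _ conn _] ins tab z8 z9.
apply: wp_seq; apply: wp_iset; apply: wp_seq; apply: wp_iset; apply: wp_seq; apply: wp_iset.
rewrite /= (in_r ins); set s0 := iwrite _ _ _ _.
have [i1 i2 i6 i3] : [/\ imem s0 0 = imem s 0, imem s0 2 = imem s 2, imem s0 6 = imem s 6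
  & forall b, 10 < b -> imem s0 b = imem s b].
  split=> // b b10; rewrite /s0 /= /write.
  by do 3![rewrite gtn_eqF ?(leq_trans _ b10) //=].
apply: (wp_for (L := 0) (H := N) (inv := fun i s' => exists q, visited q i 0 s')) => //.
- exact: (in_N ins).
- by rewrite subn0.
- by move=> j s' x y [q [*]]; exists q; split.
- exists [:: r]; split=> //.
  + by case.
  + move=> x; rewrite /= /write /= inE z8 (in_r ins) -val_eqE /=.
    by case: (_ == _).
  + by case.
- move=> i s1 _ iN sm s20 [q vis].
  have iq : i < size q.
    rewrite ltn_neqAle (vis_le vis) andbT; apply: contraTneq iN => iq.
    by rewrite (visited_all conn vis (esym iq)) ltnn.
  have E0 : imem s1 0 = imem s 0 by rewrite (sm.1 0 isT) i1.
  have E2 : imem s1 2 = imem s 2 by rewrite (sm.1 2 isT) i2.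
  have E6 : imem s1 6 = imem s 6 by rewrite (sm.1 6 isT) i6.
  apply: (wp_for (L := 0) (H := N)
    (inv := fun y s' => exists q', visited q' i y s' /\ i < size q')) => //.
  + by rewrite /= E0 (in_N ins).
  + by rewrite subn0.
  + by move=> j s' x y [q' [[*]]]; exists q'; do 2?split.
  + by exists q; split.
  + move=> y s2 _ yN sm2 s21 [q' [vis2 iq']].
    have {sm2} [F0 F2 F6 F20] : [/\ imem s2 0 = imem s 0, imem s2 2 = imem s 2,
        imem s2 6 = imem s 6 & imem s2 20 = imem s1 20].
      by rewrite (sm2.1 0 isT) (sm2.1 2 isT) (sm2.1 6 isT) (sm2.1 20 isT).
    pose yo := Ordinal yN; pose t := nth r q' i.
    have testE : imem s2 2 (imem s2 6 (imem s2 7 (imem s2 20 0)) + imem s2 21 0) = tr t yo.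
      rewrite F20 s20 (vis_nth vis2) // F6 s21 F2 tab.2; last exact: ltnW.
      by rewrite -(in_tr ins).
    have visE : imem s2 8 y = (yo \in q') by rewrite -(vis_mem vis2).
    apply: wp_if; rewrite /= testE s21 visE !lt0b.
      move=> /andP[t_y y_q].
      do 3![apply: wp_seq; apply: wp_iset]; apply: wp_iset.
      rewrite /= /write /=.
      exists (rcons q' yo); case: vis2 => U S7 S8 S9 S10 S11 [H0 H1] S12 S13 S14.
      rewrite size_rcons; split; last exact: leqW.
      split.
      * by rewrite rcons_uniq y_q.
      * by rewrite /= /write /= S7 addn1 size_rcons.
      * move=> j; rewrite size_rcons /= /write /= s21 S7 nth_rcons ltnS leq_eqVlt.
        by case: eqP => [-> _|_ /= jq]; rewrite ?ltnn ?eqxx // jq S8.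
      * move=> x; rewrite /= /write /= s21 mem_rcons inE S9 -(val_eqE x yo) /=.
        by case: (_ == _).
      * move=> j j0; rewrite size_rcons /= /write /= S7 ltnS leq_eqVlt !nth_rcons.
        case: eqP => [-> _|_ /= jq].
          by rewrite ltnn ?eqxx F20 s20 iq'; split.
        have [pj trj] := S10 j j0 jq; split=> //.
        by rewrite jq (ltn_trans pj jq).
      * by rewrite /= /write /= S7; case: eqP => // E; rewrite -E in H0.
      * by rewrite size_rcons nth_rcons H0.
      * by rewrite size_rcons; apply: leqW.
      * move=> j x ji; rewrite nth_rcons (ltn_trans ji iq') mem_rcons inE => /(S13 _ _ ji) ->.
        exact: orbT.
      * move=> x; rewrite nth_rcons iq' mem_rcons inE ltnS leq_eqVlt => /orP[/eqP xy _|xy tx].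
          by rewrite -val_eqE /= xy eqxx.
        by rewrite (S14 x xy tx) orbT.
    rewrite negb_and negbK => ty; apply: wp_skip; exists q'; split=> //.
    case: vis2 => U S7 S8 S9 S10 S11 S11' S12 S13 S14; split=> //.
    move=> x; rewrite ltnS leq_eqVlt => /orP[/eqP xy tx|]; last exact: S14.
    have xy' : x = yo by apply: val_inj.
    by move: ty; rewrite -xy' tx.
  + move=> s2 _ [q' [vis2 iq']]; exists q'.
    case: vis2 => U S7 S8 S9 S10 S11 S11' S12 S13 S14; split=> //.
    move=> j x; rewrite ltnS leq_eqVlt => /orP[/eqP ->|]; last exact: S13.
    exact: S14.
- move=> s1 sm [q vis].
  have qN : size q = N.
    apply/eqP; rewrite eqn_leq (vis_le vis) andbT.
    by rewrite -(card_uniqP (vis_uniq vis)); apply: leq_trans (max_card _) _; rewrite card_ord.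
  case: vis => U S7 S8 S9 S10 S11 [S11' S11''] S12 S13 S14; rewrite qN in S8 S10.
  exists (nth r q), (imem s1 9); split; first by split.
  split=> //.
  + by move=> i j iN jN /eqP; rewrite nth_uniq ?qN // => /eqP.
  + move=> t; have tq : t \in q; last first.
      by exists (index t q); rewrite ?nth_index //; move: tq; rewrite -index_mem qN.
    have : #|q| = #|'I_N| by rewrite (card_uniqP U) qN card_ord.
    by move/subset_cardP/(_ (subset_predT _)) => ->.
  + by move=> j j0 jN; have [] := S10 j j0 jN.
  + by move=> j j0 jN; have [] := S10 j j0 jN.
Qed.

End Program.

Definition push_state : prog :=
  Seq (ISet 14 (IAdd (var 13) (INum 1)) (IAdd (IGet 14 (var 13)) size_n))
      (ISet 13 (INum 0) (IAdd (var 13) (INum 1))).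

Definition copy_state : prog :=
  for_loop 24 (INum 0) size_n
    (Seq (ISet 11 (IAdd (IGet 14 (var 13)) (var 24)) (color (var 22) (var 24)))
      (If (TAnd (equal (color (var 22) (var 24)) (IAdd (var 23) (INum 1)))
                (positive (adjacent (var 24) (var 21))))
        (ISet 15 (INum 0) (INum 0)) Skip)).

Definition try_color : prog :=
  Seq (ISet 15 (INum 0) (INum 1))
  (Seq copy_state
  (Seq (ISet 11 (IAdd (IGet 14 (var 13)) (var 21)) (IAdd (var 23) (INum 1)))
  (Seq (If (positive (in_bag (IGet 9 (var 20)) (var 21)))
          (RSet 1 (var 13) (RGet 1 (var 22)))
          (RSet 1 (var 13) (RAdd (RGet 1 (var 22)) (RGet 0 (var 21)))))
       (If (positive (var 15)) push_state Skip)))).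

Definition extend_states : prog :=
  If (positive (in_bag (var 20) (var 21)))
    (for_loop 22 (IGet 12 (var 20)) (var 13) (for_loop 23 (INum 0) size_d try_color))
    Skip.

Definition node_states : prog :=
  Seq (ISet 12 (var 20) (var 13))
  (Seq (RSet 1 (var 13) RZero)
  (Seq (for_loop 21 (INum 0) size_n (ISet 11 (IAdd (IGet 14 (var 13)) (var 21)) (INum 0)))
  (Seq push_state (for_loop 21 (INum 0) size_n extend_states)))).

Definition list_states : prog :=
  Seq (for_loop 20 (INum 0) size_N node_states) (ISet 12 size_N (var 13)).

Section Tests.
Variables (R : realType) (s : memory R).

Lemma teval_positive x : teval s (positive x) = (0 < ieval s x).
Proof. by []. Qed.

Lemma teval_equal x y : teval s (equal x y) = (ieval s x == ieval s y).
Proof. by rewrite eqn_leq. Qed.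

Lemma teval_and b c : teval s (TAnd b c) = teval s b && teval s c.
Proof. by []. Qed.

Lemma teval_not b : teval s (TNot b) = ~~ teval s b.
Proof. by []. Qed.

End Tests.

Section Extend.
Variables (n : nat) (e : rel 'I_n).

Lemma extend_rcons (L : seq (coloring n)) f v k :
  extend e (rcons L f) v k = extend e L v k ++ extend e [:: f] v k.
Proof. by rewrite /extend -cats1 map_cat flatten_cat. Qed.

Lemma extend1S (f : coloring n) v c :
  extend e [:: f] v c.+1 = extend e [:: f] v c ++
    (if free_color e f v c.+1 then [:: upd f v c.+1] else [::]).
Proof.
have iotaE : iota 0 c.+1 = iota 0 c ++ [:: c] by rewrite -addn1 iotaD.
by rewrite /extend iotaE /= !cats0 filter_cat map_cat /=; case: ifP.
Qed.

End Extend.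

Section ListStates.
Variables (R : realType) (n N d : nat) (e : rel 'I_n) (w : 'I_n -> R).
Variables (tr : rel 'I_N) (r : 'I_N) (X : 'I_N -> {set 'I_n}) (M : nat).
Variables (o : nat -> 'I_N) (par : nat -> nat).
Hypothesis e_simple : simple_graph e.
Hypothesis par_lt : forall j, 0 < j -> j < N -> par j < j.
Hypothesis par0 : par 0 = 0.
Hypotheses (nM : n <= M) (NM : N <= M) (dM : d <= M).
Implicit Types (s : memory R) (G : seq (nat * coloring n)).

Let bag (j : nat) : {set 'I_n} := X (o j).
Local Notation sts := (states d e bag).
Local Notation wt := (own_weight w bag par).
Local Notation x0 := (0, [ffun=> 0] : coloring n).

Hypothesis few_states : forall j k, k <= n -> size (colorings d e (bag j) k) <= M.

Record ready s : Prop := Ready {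
  ready_in : inputs d e w tr r X s;
  ready_tab : tables n N s;
  ready_ord : ordered o par s }.

Lemma ready_same P s s' : same P s s' ->
  all (fun a => a \notin imods P) [:: 0; 1; 2; 3; 5; 6; 7; 9] -> 0 \notin rmods P ->
  ready s -> ready s'.
Proof.
move=> sm /and5P[a0 a1 a2 a3 /and5P[a5 a6 a7 a9 _]] r0 [ins [t5 t6] [o7 o9]].
split; first by apply: inputs_same sm _ r0 ins; rewrite /= a0 a1 a2 a3.
  by split=> *; rewrite ?(sm.1 5) ?(sm.1 6) ?t5 ?t6.
by split=> *; rewrite ?(sm.1 7) ?(sm.1 9) ?o7 ?o9.
Qed.

Lemma ready_iwrite s a i x : a \notin [:: 0; 1; 2; 3; 5; 6; 7; 9] ->
  ready s -> ready (iwrite s a i x).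
Proof.
move=> ha; have sm := exec_same (exec_iset s a (INum i) (INum x)).
apply: (ready_same sm) => //; apply/allP => b hb.
by rewrite inE; apply: contraNneq ha => <-.
Qed.

Lemma ready_rwrite s i (x : R) : ready s -> ready (rwrite s 1 i x).
Proof. by case=> -[????????] [??] [??]; split; split. Qed.

Lemma par_ltN j : j < N -> par j < N.
Proof. by case: j => [|j] jN; rewrite ?par0 // (ltn_trans (par_lt _ jN)). Qed.

Lemma adjacentE s (u v : 'I_n) : ready s -> imem s 1 (imem s 5 u + v) = e u v.
Proof.
move=> [ins [t5 _] _]; rewrite t5 ?(in_e ins) //.
by apply: leq_trans (ltnW (ltn_ord u)) (leq_addr _ _).
Qed.

Lemma in_bagE s j (v : 'I_n) : ready s -> j < N ->
  imem s 3 (imem s 5 (imem s 7 j) + v) = (v \in bag j).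
Proof.
move=> [ins [t5 _] [o7 _]] jN; rewrite o7 // t5 ?(in_X ins) //.
by apply: leq_trans (ltnW (ltn_ord _)) (leq_addl _ _).
Qed.

Record represents G s : Prop := Represents {
  rep_size : imem s 13 0 = size G;
  rep_off : forall i, i <= size G -> imem s 14 i = i * n;
  rep_col : forall i (u : 'I_n), i < size G -> imem s 11 (i * n + u) = (nth x0 G i).2 u;
  rep_val : forall i, i < size G -> rmem s 1 i = wt (nth x0 G i) }.

Lemma row_neq i k u v : i < k -> u < n -> (i * n + u == k * n + v) = false.
Proof.
move=> ik un; apply: ltn_eqF; apply: leq_trans (leq_addr _ _).
by apply: leq_trans (_ : i.+1 * n <= _); rewrite ?leq_mul2r ?ik ?orbT // mulSn addnC ltn_add2r.
Qed.

Lemma wp_push_state G s (x : nat * coloring n) : imem s 0 0 = n -> represents G s ->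
  (forall u : 'I_n, imem s 11 (size G * n + u) = x.2 u) ->
  rmem s 1 (size G) = wt x ->
  wp M push_state s (represents (rcons G x)).
Proof.
move=> in_n [r13 r14 r11 r1] row val; apply: wp_seq; apply: wp_iset; apply: wp_iset.
split; rewrite ?size_rcons /= /write /= ?r13 ?addn1 //.
- move=> i; rewrite in_n leq_eqVlt r14 //; case: eqP => [-> _|_ iG] /=; first by rewrite mulSn addnC.
  exact: r14.
- move=> i u; rewrite ltnS leq_eqVlt nth_rcons; case: eqP => [-> _|_ /= iG]; first by rewrite ltnn row.
  by rewrite iG r11.
- move=> i; rewrite ltnS leq_eqVlt nth_rcons; case: eqP => [-> _|_ /= iG]; first by rewrite ltnn val.
  by rewrite iG r1.
Qed.

Lemma own_weight_upd j (f : coloring n) v c : f v = 0 ->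
  wt (j, upd f v c.+1) =
    (if v \in bag (par j) then wt (j, f) else wt (j, f) + w v)%R.
Proof.
move=> fv; rewrite /own_weight /=.
case: ifP => vp.
  apply: eq_bigl => u; rewrite ffunE; case: (u =P v) => // ->.
  by rewrite vp !andbF.
rewrite (bigD1 v) /=; last by rewrite ffunE eqxx vp.
rewrite addrC; congr (_ + _)%R; apply: eq_bigl => u; rewrite ffunE.
by case: (u =P v) => [->|_]; rewrite ?fv ?andbF ?andbT.
Qed.

Lemma wp_try_color G s j i (v : 'I_n) c : ready s -> represents G s -> j < N ->
  imem s 20 0 = j -> imem s 21 0 = v -> imem s 22 0 = i -> imem s 23 0 = c ->
  i < size G -> (nth x0 G i).1 = j -> (nth x0 G i).2 v = 0 ->
  wp M try_color s (represents (G ++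
    if free_color e (nth x0 G i).2 v c.+1 then [:: (j, upd (nth x0 G i).2 v c.+1)] else [::])).
Proof.
move=> rdy rep jN s20 s21 s22 s23 iG Gj; set f := (nth x0 G i).2 => fv.
apply: wp_seq; apply: wp_iset; set s0 := iwrite _ _ _ _.
have rdy0 : ready s0 by apply: ready_iwrite.
have rep0 : represents G s0 by case: rep => *.
apply: wp_seq; apply: (wp_for (L := 0) (H := n) (inv := fun y s' =>
   [/\ represents G s', forall u : 'I_n, u < y -> imem s' 11 (size G * n + u) = f u
    & imem s' 15 0 = [forall u : 'I_n, (u < y) ==> ~~ ((f u == c.+1) && e u v)]])) => //.
- exact: in_n (ready_in rdy0).
- by rewrite subn0.
- by move=> y s' x z [[? ? ? ?] ? ?]; split=> //; split.
- by split=> //; rewrite /= /write /=; case: forallP => // -[].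
- move=> y s1 _ yn sm s24 [rep1 row flag]; have rdy1 := ready_same sm isT isT rdy0.
  have [E13 E20 E21 E22 E23] : [/\ imem s1 13 0 = size G, imem s1 20 0 = j,
      imem s1 21 0 = v, imem s1 22 0 = i & imem s1 23 0 = c].
    by rewrite (rep_size rep1) (sm.1 20 isT) (sm.1 21 isT) (sm.1 22 isT) (sm.1 23 isT).
  pose y' := Ordinal yn.
  have colE : imem s1 11 (imem s1 14 i + y) = f y'.
    by rewrite (rep_off rep1) ?(ltnW iG) // -(rep_col rep1 y' iG).
  apply: wp_seq; apply: wp_iset; rewrite /= E13 E22 s24 colE (rep_off rep1) //.
  set s2 := iwrite _ _ _ _.
  have rdy2 : ready s2 by apply: ready_iwrite.
  have rep2 : represents G s2.
    case: rep1 => r13 r14 r11 r1; split=> // k u kG.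
    by rewrite /= /write /= row_neq // r11.
  have row2 (u : 'I_n) : u < y.+1 -> imem s2 11 (size G * n + u) = f u.
    rewrite /= /write /= eqn_add2l ltnS leq_eqVlt; case: eqP => [uy _|_ /row //].
    by congr (f _); apply: val_inj.
  have colE2 : ieval s2 (color (var 22) (var 24)) = f y'.
    rewrite -row2 //= /write /= s24 E22 (rep_off rep1) ?(ltnW iG) // row_neq // eqxx.
    by rewrite (rep_col rep1 y' iG).
  have adjE : ieval s2 (adjacent (var 24) (var 21)) = e y' v.
    by rewrite /= /write /= s24 E21 -[y]/(val y') adjacentE.
  have flagE : [forall u : 'I_n, (u < y.+1) ==> ~~ ((f u == c.+1) && e u v)] =
      [forall u : 'I_n, (u < y) ==> ~~ ((f u == c.+1) && e u v)] && ~~ ((f y' == c.+1) && e y' v).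
    apply/forallP/andP => [H|[/forallP H Hy] u].
      split; last exact: (implyP (H y')).
      by apply/forallP => u; apply/implyP => uy; apply: (implyP (H u)); apply: ltnW.
    apply/implyP; rewrite ltnS leq_eqVlt => /orP[/eqP uy|]; last exact: (implyP (H u)).
    by have -> : u = y' by apply: val_inj.
  have testE : teval s2 (TAnd (equal (color (var 22) (var 24)) (IAdd (var 23) (INum 1)))
      (positive (adjacent (var 24) (var 21)))) = (f y' == c.+1) && e y' v.
    rewrite teval_and teval_equal teval_positive colE2 adjE lt0b.
    by rewrite /= /write /= E23 addn1.
  apply: wp_if; rewrite testE => test.
    apply: wp_iset; split; first by case: rep2 => *.
      by move=> u /row2.
    by rewrite flagE test andbF.
  apply: wp_skip; split=> //; rewrite flagE test andbT.
  by rewrite /= /write /= flag.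
move=> s1 sm [rep1 row flag]; have rdy1 := ready_same sm isT isT rdy0.
have [E13 E20 E21 E22 E23] : [/\ imem s1 13 0 = size G, imem s1 20 0 = j,
    imem s1 21 0 = v, imem s1 22 0 = i & imem s1 23 0 = c].
  by rewrite (rep_size rep1) (sm.1 20 isT) (sm.1 21 isT) (sm.1 22 isT) (sm.1 23 isT).
have {}flag : imem s1 15 0 = free_color e f v c.+1.
  by rewrite flag; congr (nat_of_bool _); apply: eq_forallb => u; rewrite ltn_ord.
apply: wp_seq; apply: wp_iset; rewrite /= E13 E21 E23 addn1 (rep_off rep1) //.
set s2 := iwrite _ _ _ _.
have rdy2 : ready s2 by apply: ready_iwrite.
have rep2 : represents G s2.
  case: rep1 => r13 r14 r11 r1; split=> // k u kG.
  by rewrite /= /write /= row_neq // r11.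
have row2 (u : 'I_n) : imem s2 11 (size G * n + u) = upd f v c.+1 u.
  by rewrite /= /write /= ffunE eqn_add2l val_eqE; case: eqP => // _; apply: row.
have {}flag : imem s2 15 0 = free_color e f v c.+1 by [].
have vpE : ieval s2 (in_bag (IGet 9 (var 20)) (var 21)) = (v \in bag (par j)).
  rewrite -[ieval _ _]/(imem s2 3 (imem s2 5 (imem s2 7 (imem s2 9 (imem s1 20 0))) + imem s1 21 0)).
  rewrite E20 E21.
  by rewrite (order_par (ready_ord rdy2)) // in_bagE // par_ltN.
apply: wp_seq; pose x := (j, upd f v c.+1).
apply: (wp_use (Q' := fun s3 => represents G s3 /\ rmem s3 1 (size G) = wt x)).
  have v13 : ieval s2 (var 13) = size G by [].
  have fE : rmem s2 1 i = wt (j, f).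
    by rewrite (rep_val rep2) // -Gj -surjective_pairing.
  have v22 : reval s2 (RGet 1 (var 22)) = wt (j, f) by rewrite -fE -E22.
  have v0 : reval s2 (RGet 0 (var 21)) = w v.
    by rewrite -(in_w (ready_in rdy2)) -E21.
  apply: wp_if; rewrite teval_positive vpE lt0b => vp.
    apply: wp_rset; rewrite v13 v22; split.
      case: rep2 => r13 r14 r11 r1; split=> // k kG; rewrite /= /write /=.
      by rewrite ltn_eqF // r1.
    by rewrite /= /write /= eqxx own_weight_upd // vp.
  apply: wp_rset; rewrite v13 -[reval _ _]/(reval s2 (RGet 1 (var 22)) + reval s2 (RGet 0 (var 21)))%R.
  rewrite v22 v0; split.
    case: rep2 => r13 r14 r11 r1; split=> // k kG; rewrite /= /write /=.
    by rewrite ltn_eqF // r1.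
  by rewrite /= /write /= eqxx own_weight_upd // (negbTE vp).
move=> s3 sm3 [rep3 val3]; apply: wp_if.
  rewrite teval_positive /= (sm3.1 15 isT) flag lt0b => ->; rewrite cats1.
  apply: wp_push_state => //.
    by rewrite (sm3.1 0 isT) (in_n (ready_in rdy2)).
  by move=> u; rewrite (sm3.1 11 isT) row2.
rewrite teval_positive /= (sm3.1 15 isT) flag lt0b => /negbTE ->.
by apply: wp_skip; rewrite cats0.
Qed.

Local Notation tag j L := [seq (j, f) | f <- L].

Lemma wp_extend_states s j (v : 'I_n) (L : seq (coloring n)) : ready s -> j < N ->
  represents (sts j ++ tag j L) s -> imem s 12 j = size (sts j) ->
  imem s 20 0 = j -> imem s 21 0 = v -> (forall f, f \in L -> f v = 0) -> size L <= M ->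
  wp M extend_states s (represents (sts j ++ tag j (extensions d e (bag j) L v))).
Proof.
move=> rdy jN rep s12 s20 s21 Lv LM.
have vE : ieval s (in_bag (var 20) (var 21)) = (v \in bag j).
  by rewrite /= s20 s21 in_bagE.
apply: wp_if; rewrite teval_positive vE lt0b => vj; last first.
  by apply: wp_skip; rewrite /extensions (negbTE vj).
rewrite /extensions vj; set S0 := size (sts j).
have sizeE : size (sts j ++ tag j L) = S0 + size L by rewrite size_cat size_map.
apply: (wp_for (L := S0) (H := S0 + size L) (inv := fun k s' =>
    represents (sts j ++ tag j (L ++ extend e (take (k - S0) L) v d)) s')) => //.
- by rewrite /= (rep_size rep).
- by move=> x; rewrite /= /write /= s20.
- exact: leq_addr.
- by rewrite addKn.
- by move=> k s' x y [*]; split.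
- by rewrite subnn take0 cats0.
- move=> k s1 Sk; set k' := k - S0; have {Sk} -> : k = S0 + k' by rewrite subnKC.
  rewrite ltn_add2l => kL sm s22 rep1.
  have rdy1 := ready_same sm isT isT rdy.
  rewrite -addnS addKn (take_nth [ffun=> 0]) // extend_rcons; set f := nth _ L k'.
  have nthE Z : nth x0 (sts j ++ tag j (L ++ Z)) (S0 + k') = (j, f).
    by rewrite nth_cat ltnNge leq_addr /= addKn map_cat nth_cat size_map kL (nth_map [ffun=> 0]).
  apply: (wp_for (L := 0) (H := d) (inv := fun c s' =>
    represents (sts j ++ tag j (L ++ extend e (take k' L) v d ++ extend e [:: f] v c)) s')) => //.
  + exact: (in_d (ready_in rdy1)).
  + by rewrite subn0.
  + by move=> c s' x y [*]; split.
  + by rewrite /= !cats0.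
  move=> c s2 _ cd sm2 s23 rep2; have rdy2 := ready_same sm2 isT isT rdy1.
  have [E20 E21 E22] : [/\ imem s2 20 0 = j, imem s2 21 0 = v & imem s2 22 0 = S0 + k'].
    by rewrite (sm2.1 20 isT) (sm2.1 21 isT) (sm2.1 22 isT) (sm.1 20 isT) (sm.1 21 isT).
  have := wp_try_color rdy2 rep2 jN E20 E21 E22 s23.
  rewrite nthE size_cat size_map size_cat -/S0 ltn_add2l ltn_addr //=.
  move=> /(_ isT erefl (Lv _ _)) H.
  apply: (wp_use (H _)) => [|s3 _]; first by rewrite mem_nth.
  rewrite extend1S 2!map_cat -catA; congr represents.
  rewrite [in RHS]catA [in RHS]catA [in RHS]catA !map_cat -!catA; do !congr (_ ++ _).
  by case: ifP.
- by move=> s1 _; rewrite addKn take_size.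
Qed.

Lemma wp_node_states s j : ready s -> j < N -> represents (sts j) s -> imem s 20 0 = j ->
  wp M node_states s (fun s' => represents (sts j.+1) s' /\
    forall i, imem s' 12 i = if i == j then size (sts j) else imem s 12 i).
Proof.
move=> rdy jN rep s20; pose x : nat * coloring n := (j, [ffun=> 0]).
apply: wp_seq; apply: wp_iset; apply: wp_seq; apply: wp_rset.
set s1 := rwrite _ _ _ _.
have S1E : imem s 13 0 = size (sts j) := rep_size rep.
have rdy1 : ready s1 by apply: ready_rwrite; apply: ready_iwrite.
have rep1 : represents (sts j) s1.
  case: rep => r13 r14 r11 r1; split=> // i iS; rewrite /= /write /= r13.
  by rewrite ltn_eqF // r1.
have val1 : rmem s1 1 (size (sts j)) = wt x.
  rewrite /= /write /= S1E eqxx /own_weight big_pred0 // => u.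
  by rewrite /= ffunE eqxx.
have s1_12 i : imem s1 12 i = if i == j then size (sts j) else imem s 12 i.
  by rewrite /= /write /= s20 S1E.
have s1_20 : imem s1 20 0 = j by rewrite /= /write /=.
move: s1 rdy1 rep1 val1 s1_12 s1_20 => s1 rdy1 rep1 val1 s1_12 s1_20 {s20 rdy rep S1E}.
apply: wp_seq.
apply: (wp_for (L := 0) (H := n) (inv := fun y s' => represents (sts j) s' /\
   forall u : 'I_n, u < y -> imem s' 11 (size (sts j) * n + u) = 0)) => //.
- exact: (in_n (ready_in rdy1)).
- by rewrite subn0.
- by move=> y s' z t [[*]]; do 2?split.
- move=> y s2 _ yn sm s21 [rep2 row]; apply: wp_iset.
  rewrite -[ieval s2 _]/(imem s2 14 (imem s2 13 0) + imem s2 21 0) s21 (rep_size rep2) (rep_off rep2) //.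
  split; last first.
    move=> u; rewrite /= /write /= eqn_add2l ltnS leq_eqVlt.
    by case: eqP => // _ /row.
  case: rep2 => r13 r14 r11 r1; split=> // k u kS.
  by rewrite /= /write /= row_neq // r11.
move=> s2 sm [rep2 row]; have rdy2 := ready_same sm isT isT rdy1.
apply: wp_seq; apply: wp_use (wp_push_state (x := x) _ rep2 _ _) _.
- exact: (in_n (ready_in rdy2)).
- by move=> u; rewrite ffunE row.
- by rewrite (sm.2 1 isT).
move=> s3 sm3 rep3; have rdy3 := ready_same sm3 isT isT rdy2.
have s3_12 : imem s3 12 j = size (sts j).
  by rewrite (sm3.1 12 isT) (sm.1 12 isT) s1_12 eqxx.
apply: (wp_for (L := 0) (H := n) (inv := fun y s' =>
   represents (sts j ++ tag j (colorings d e (bag j) y)) s')) => //.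
- exact: (in_n (ready_in rdy3)).
- by rewrite subn0.
- by move=> y s' z t [*]; split.
- by rewrite /= cats1.
- move=> y s4 _ yn sm4 s21 rep4; have rdy4 := ready_same sm4 isT isT rdy3.
  rewrite -[y]/(val (Ordinal yn)) coloringsS; apply: wp_extend_states => //.
  + by rewrite (sm4.1 12 isT).
  + by rewrite (sm4.1 20 isT) (sm3.1 20 isT) (sm.1 20 isT).
  + by move=> f; rewrite mem_colorings ?(ltnW yn) // => /andP[_ /supportedP]; apply.
  + by apply: few_states; apply: ltnW.
move=> s4 sm4 rep4; split; first by rewrite statesS.
by move=> i; rewrite (sm4.1 12 isT) (sm3.1 12 isT) (sm.1 12 isT) s1_12.
Qed.

Lemma wp_list_states s : ready s -> imem s 13 0 = 0 -> imem s 14 0 = 0 ->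
  wp M list_states s (fun s' => represents (sts N) s' /\
    forall j, j <= N -> imem s' 12 j = start d e bag j).
Proof.
move=> rdy s13 s14; apply: wp_seq.
apply: (wp_for (L := 0) (H := N) (inv := fun j s' => represents (sts j) s' /\
   forall i, i < j -> imem s' 12 i = start d e bag i)) => //.
- exact: (in_N (ready_in rdy)).
- by rewrite subn0.
- by move=> j s' x y [[*]]; do 2?split.
- by split=> //; split=> //= i; rewrite leqn0 => /eqP ->.
- move=> j s1 _ jN sm s20 [rep1 s12]; have rdy1 := ready_same sm isT isT rdy.
  apply: wp_use (wp_node_states rdy1 jN rep1 s20) _ => s2 _ [rep2 s2_12]; split=> //.
  by move=> i; rewrite ltnS leq_eqVlt s2_12; case: eqP => [->|_ /s12].
move=> s1 sm [rep1 s12]; have rdy1 := ready_same sm isT isT rdy.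
apply: wp_iset; split; first by case: rep1 => *; split.
move=> j; rewrite leq_eqVlt /= /write /= (in_N (ready_in rdy1)) (rep_size rep1).
by case: eqP => [-> //|_ /s12].
Qed.

End ListStates.

Definition check_compat : prog :=
  for_loop 24 (INum 0) size_n
    (If (TAnd (TAnd (positive (in_bag (var 20) (var 24)))
                    (positive (in_bag (IGet 9 (var 20)) (var 24))))
              (TNot (equal (color (var 22) (var 24)) (color (var 23) (var 24)))))
      (ISet 15 (INum 0) (INum 0)) Skip).

(* The value [0] of cell 16 means that no compatible state has been found: the
   state [0] belongs to the root, whereas the search is in the states of
   another node. *)
Definition find_best : prog :=
  Seq (ISet 16 (INum 0) (INum 0))
    (for_loop 23 (IGet 12 (var 20)) (IGet 12 (IAdd (var 20) (INum 1)))
      (Seq (ISet 15 (INum 0) (INum 1))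
      (Seq check_compat
        (If (TAnd (positive (var 15))
                  (TNot (TAnd (positive (var 16))
                              (TNot (TLeR (RGet 1 (var 16)) (RGet 1 (var 23)))))))
          (ISet 16 (INum 0) (var 23)) Skip)))).

Definition eliminate : prog :=
  for_loop 21 (INum 1) size_N
    (Seq (ISet 20 (INum 0) (ISub size_N (var 21)))
      (for_loop 22 (IGet 12 (IGet 9 (var 20))) (IGet 12 (IAdd (IGet 9 (var 20)) (INum 1)))
        (Seq find_best (RSet 1 (var 22) (RAdd (RGet 1 (var 22)) (RGet 1 (var 16))))))).

Definition mark_colored : prog :=
  for_loop 24 (INum 0) size_n
    (If (positive (color (var 16) (var 24))) (ISet 4 (var 24) (INum 1)) Skip).

Definition read_off : prog :=
  for_loop 20 (INum 1) size_N
    (Seq (ISet 22 (INum 0) (IGet 17 (IGet 9 (var 20))))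
    (Seq find_best
    (Seq (ISet 17 (var 20) (var 16)) mark_colored))).

Section Search.
Variables (R : realType) (n N d : nat) (e : rel 'I_n) (w : 'I_n -> R).
Variables (tr : rel 'I_N) (r : 'I_N) (X : 'I_N -> {set 'I_n}) (M : nat).
Variables (o : nat -> 'I_N) (par : nat -> nat).
Hypothesis e_simple : simple_graph e.
Hypothesis N_gt0 : 0 < N.
Hypothesis par_lt : forall j, 0 < j -> j < N -> par j < j.
Hypothesis par0 : par 0 = 0.
Hypotheses (nM : n <= M) (NM : N <= M).
Implicit Types s : memory R.

Let bag (j : nat) : {set 'I_n} := X (o j).
Local Notation start := (start d e bag).
Local Notation state := (state N d e bag).
Local Notation state_of := (state_of d e bag).
Local Notation best := (best N d e bag par).
Local Notation compat := (compat N d e bag par).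
Local Notation elim_inv := (elim_inv N d e w bag par).

Hypothesis few_states : forall j, size (bag_colorings d e bag j) <= M.

Record listed s : Prop := Listed {
  listed_ready : ready d e w tr r X o par s;
  listed_off : forall i, i < start N -> imem s 14 i = i * n;
  listed_col : forall i (u : 'I_n), i < start N -> imem s 11 (i * n + u) = (state i).2 u;
  listed_start : forall j, j <= N -> imem s 12 j = start j }.

Lemma listed_same P s s' : same P s s' ->
  all (fun a => a \notin imods P) [:: 0; 1; 2; 3; 5; 6; 7; 9; 11; 12; 14] ->
  0 \notin rmods P -> listed s -> listed s'.
Proof.
move=> sm; rewrite [all _ _](all_cat _ [:: 0; 1; 2; 3; 5; 6; 7; 9] [:: 11; 12; 14]).
case/andP => a_rdy /and4P[a11 a12 a14 _] r0 [rdy r14 r11 r12].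
split; first exact: ready_same sm a_rdy r0 rdy.
- by move=> i iN; rewrite (sm.1 14) ?r14.
- by move=> i u iN; rewrite (sm.1 11) ?r11.
- by move=> j jN; rewrite (sm.1 12) ?r12.
Qed.

Lemma listed_iwrite s a i x : a \notin [:: 0; 1; 2; 3; 5; 6; 7; 9; 11; 12; 14] ->
  listed s -> listed (iwrite s a i x).
Proof.
move=> ha; have sm := exec_same (exec_iset s a (INum i) (INum x)).
apply: (listed_same sm) => //; apply/allP => b hb.
by rewrite inE; apply: contraNneq ha => <-.
Qed.

Lemma colorE s i (u : 'I_n) : listed s -> i < start N ->
  imem s 11 (imem s 14 i + u) = (state i).2 u.
Proof. by move=> ls iN; rewrite (listed_off ls) // (listed_col ls). Qed.

Lemma state_of00 : state_of 0 0.
Proof.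
rewrite /state_of /= startS addn_gt0; apply/orP; right.
case E : (bag_colorings _ _ _ _) (mem_colorings d (bag 0) e_simple [ffun=> 0] (leqnn n)) => //.
rewrite -/(bag_colorings d e bag 0) E in_nil => /esym/andP[]; split.
  by apply/validP; split=> [v|u v]; rewrite ffunE.
by apply/supportedP => v; rewrite ffunE.
Qed.

Lemma start_gt0 i : 0 < i -> 0 < start i.
Proof.
move=> i0; have /andP[_ /leq_trans] := state_of00; apply; exact: leq_start.
Qed.

Lemma wp_find_best s i f : listed s -> 0 < i -> i < N -> imem s 20 0 = i ->
  imem s 22 0 = f -> state_of (par i) f ->
  wp M find_best s (fun s' => best (rmem s 1) i f (imem s' 16 0)).
Proof.
move=> ls i0 iN s20 s22 fp.
have pN : par i < N by apply: ltn_trans (par_lt i0 iN) iN.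
have fN : f < start N by apply: state_of_ltN fp.
apply: wp_seq; apply: wp_iset; set s0 := iwrite _ _ _ _.
have {ls} ls : listed s0 by apply: listed_iwrite.
have [s0_20 s0_22] : imem s0 20 0 = i /\ imem s0 22 0 = f by [].
have s0_16 : imem s0 16 0 = 0 by [].
have s0_r : rmem s0 1 = rmem s 1 by [].
rewrite -{}s0_r; move: s0 ls s0_20 s0_22 s0_16 => {s20 s22}s ls s20 s22 s16.
pose val := rmem s 1.
apply: (wp_for (L := start i) (H := start i.+1) (inv := fun g s' =>
   let b := imem s' 16 0 in
   (forall h, start i <= h -> h < g -> compat i f h -> 0 < b /\ (val h <= val b)%R) /\
   (0 < b -> [/\ start i <= b, b < g & compat i f b]))) => //.
- by rewrite /= s20 addn1 (listed_start ls).
- by move=> x; rewrite /= /write /= s20 (listed_start ls) // ltnW.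
- exact: leq_start.
- by rewrite startS addKn.
- split; last by rewrite s16.
  by move=> h ih /(leq_ltn_trans ih); rewrite ltnn.
- move=> g s1 ig gi sm s23 [upper att]; have ls1 := listed_same sm isT isT ls.
  have gN : g < start N by apply: leq_trans gi (leq_start _ _ _ iN).
  apply: wp_seq; apply: wp_iset; set s2 := iwrite _ _ _ _.
  have ls2 : listed s2 by apply: listed_iwrite.
  have [E20 E22 E23] : [/\ imem s2 20 0 = i, imem s2 22 0 = f & imem s2 23 0 = g].
    by rewrite -s23 -s20 -s22 -(sm.1 20 isT) -(sm.1 22 isT).
  have [E16 Er] : imem s2 16 0 = imem s1 16 0 /\ rmem s2 1 = val by split=> //; exact: sm.2 1 isT.
  have E15 : imem s2 15 0 = 1 by [].
  move: (s2) ls2 E20 E22 E23 E16 Er E15 => {s2}s2 ls2 E20 E22 E23 E16 Er E15.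
  pose ok (u : 'I_n) := (u \in bag i) && (u \in bag (par i)) ==> ((state f).2 u == (state g).2 u).
  apply: wp_seq; apply: (wp_for (L := 0) (H := n)
    (inv := fun y s' => imem s' 15 0 = [forall u : 'I_n, (u < y) ==> ok u])) => //.
  + exact: (in_n (ready_in (listed_ready ls2))).
  + by rewrite subn0.
  + by rewrite E15; case: forallP => // -[].
  + move=> y s3 _ yn sm3 s24 flag; have ls3 := listed_same sm3 isT isT ls2.
    pose y' := Ordinal yn.
    have testE : teval s3 (TAnd (TAnd (positive (in_bag (var 20) (var 24)))
        (positive (in_bag (IGet 9 (var 20)) (var 24))))
        (TNot (equal (color (var 22) (var 24)) (color (var 23) (var 24))))) = ~~ ok y'.
      rewrite 2!teval_and teval_not teval_equal !teval_positive /=.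
      rewrite (sm3.1 20 isT) (sm3.1 22 isT) (sm3.1 23 isT) E20 E22 E23 s24.
      have rdy3 := listed_ready ls3.
      rewrite (order_par (ready_ord rdy3)) // -[y]/(nat_of_ord y') !(in_bagE _ rdy3) // !lt0b.
      by rewrite !(colorE _ ls3) // negb_imply.
    have flagE : [forall u : 'I_n, (u < y.+1) ==> ok u] =
        [forall u : 'I_n, (u < y) ==> ok u] && ok y'.
      apply/forallP/andP => [H|[/forallP H Hy] u].
        split; last exact: (implyP (H y')).
        by apply/forallP => u; apply/implyP => uy; apply: (implyP (H u)); apply: ltnW.
      apply/implyP; rewrite ltnS leq_eqVlt => /orP[/eqP uy|]; last exact: (implyP (H u)).
      by have -> : u = y' by apply: val_inj.
    apply: wp_if; rewrite testE => test.
      by apply: wp_iset; rewrite flagE (negbTE test) andbF.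
    by apply: wp_skip; rewrite flagE (negbNE test) andbT flag.
  move=> s3 sm3 flag.
  have {}flag : imem s3 15 0 = compat i f g.
    by rewrite flag; congr (nat_of_bool _); apply: eq_forallb => u; rewrite ltn_ord.
  have F16 : imem s3 16 0 = imem s1 16 0 by rewrite (sm3.1 16 isT).
  have F23 : imem s3 23 0 = g by rewrite (sm3.1 23 isT).
  have Fr : rmem s3 1 = val by rewrite (sm3.2 1 isT).
  set b := imem s1 16 0 in F16 upper att *.
  have testE : teval s3 (TAnd (positive (var 15)) (TNot (TAnd (positive (var 16))
      (TNot (TLeR (RGet 1 (var 16)) (RGet 1 (var 23))))))) =
      compat i f g && ((b == 0) || (val b <= val g)%R).
    rewrite /= Fr F16 F23 flag lt0b; congr (_ && _).
    by rewrite negb_and negbK -leqNgt leqn0.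
  have g0 : 0 < g by apply: leq_trans (start_gt0 i0) ig.
  apply: wp_if; rewrite testE => test.
    apply: wp_iset; rewrite -[ieval _ (var 23)]/(imem s3 23 0) F23 /= /write /=.
    case/andP: test => cg bg; split; last by [].
    move=> h ih; rewrite ltnS leq_eqVlt => /orP[/eqP -> //|hg ch].
    have [b0 hb] := upper h ih hg ch; split=> //.
    by move: bg; rewrite eqn0Ngt b0 => /(le_trans hb).
  apply: wp_skip; rewrite F16; split; last first.
    by case/att => ib bg cb; split=> //; apply: leqW.
  move=> h ih; rewrite ltnS leq_eqVlt => /orP[/eqP -> cg|]; last exact: upper.
  move: test; rewrite cg negb_or -lt0n => /andP[b0 bg]; split=> //.
  by apply: ltW; rewrite ltNge.
move=> s1 _ [upper att].
have [g /andP[ig gi] cg] := exists_compat e_simple par_lt i0 iN fp.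
have [b0 _] := upper g ig gi cg; have [ib bi cb] := att b0.
split=> //; first by rewrite /state_of ib.
by move=> h /andP[ih hi] /(upper h ih hi)[].
Qed.

Lemma wp_eliminate s : listed s -> elim_inv N (rmem s 1) ->
  wp M eliminate s (fun s' => elim_inv 1 (rmem s' 1)).
Proof.
move=> ls inv0.
apply: (wp_for (L := 1) (H := N) (inv := fun k s' => elim_inv (N.+1 - k) (rmem s' 1))) => //.
- exact: (in_N (ready_in (listed_ready ls))).
- by apply: leq_trans (leq_subr _ _) NM.
- by rewrite subn1.
- move=> k s1 k0 kN sm s21; have ls1 := listed_same sm isT isT ls.
  set i := N - k; have i0 : 0 < i by rewrite subn_gt0.
  have iN : i < N by rewrite /i -subn_gt0 subKn // ltnW.
  rewrite (subSn (ltnW kN)) -/i subSS -/i => inv.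
  have pi := par_lt i0 iN; have pN := ltn_trans pi iN.
  apply: wp_seq; apply: wp_iset; set s2 := iwrite _ _ _ _.
  have ls2 : listed s2 by apply: listed_iwrite.
  have s20 : imem s2 20 0 = i.
    by rewrite /= /write /= s21 (in_N (ready_in (listed_ready ls1))).
  pose val := rmem s1 1.
  have val2 : rmem s2 1 = val by [].
  move: s2 ls2 s20 val2 => s2 ls2 s20 val2.
  have par2 : imem s2 9 i = par i by rewrite (order_par (ready_ord (listed_ready ls2))).
  apply: (wp_for (L := start (par i)) (H := start (par i).+1) (inv := fun f0 s' =>
    (forall f, start (par i) <= f -> f < f0 ->
       exists2 b, best val i f b & rmem s' 1 f = (val f + val b)%R) /\
    (forall f, ~~ ((start (par i) <= f) && (f < f0)) -> rmem s' 1 f = val f))) => //.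
  + by rewrite /= s20 par2 addn1 (listed_start ls2).
  + by move=> x; rewrite /= /write /= s20 par2 (listed_start ls2) // ltnW.
  + exact: leq_start.
  + by rewrite startS addKn.
  + split; last by rewrite val2.
    by move=> f pf /(leq_ltn_trans pf); rewrite ltnn.
  + move=> f s3 pf fp sm3 s22 [raised kept]; have ls3 := listed_same sm3 isT isT ls2.
    have stf : state_of (par i) f by rewrite /state_of pf.
    have s3_20 : imem s3 20 0 = i by rewrite (sm3.1 20 isT).
    have keep_i g : state_of i g -> rmem s3 1 g = val g.
      move=> gi; apply: kept; apply/negP => /andP[pg gf].
      have gp : state_of (par i) g by rewrite /state_of pg (ltn_trans gf).
      by move: pi; rewrite (state_of_inj pN iN gp gi) ltnn.
    apply: wp_seq; apply: wp_use (wp_find_best ls3 i0 iN s3_20 s22 stf) _ => s4 sm4.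
    set b := imem s4 16 0 => -[ib cb maxb].
    apply: wp_rset.
    have -> : ieval s4 (var 22) = f by rewrite /= (sm4.1 22 isT).
    have -> : reval s4 (RAdd (RGet 1 (var 22)) (RGet 1 (var 16))) = (val f + val b)%R.
      rewrite /= (sm4.1 22 isT) s22 -/b (sm4.2 1 isT) (keep_i b) // kept //.
      by rewrite ltnn andbF.
    have bestb : best val i f b.
      by split=> // g gi cg; rewrite -!keep_i // maxb.
    split=> h; rewrite /= /write /= (sm4.2 1 isT).
      move=> ph; rewrite ltnS leq_eqVlt.
      by case: eqP => [-> _|_ /= hf]; [exists b | apply: raised].
    case: eqP => [->|/eqP hf]; first by rewrite pf ltnSn.
    move=> nh; apply: kept; apply: contra nh => /andP[-> /= hf']; exact: leqW.
  move=> s3 sm3 [raised kept]; apply: elim_inv_step inv _ => //.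
  split; first by move=> f /andP[pf fp]; apply: raised.
  by move=> f _ nf; apply: kept.
- by move=> s1 _; rewrite subSnn.
Qed.

Lemma wp_read_off s : bag 0 = set0 -> listed s -> (forall v, imem s 4 v = 0) -> imem s 17 0 = 0 ->
  wp M read_off s (fun s' => exists sg, [/\ sg 0 = 0,
    forall j, 0 < j -> j < N -> best (rmem s 1) j (sg (par j)) (sg j)
    & output n s' = selected N d e bag sg]).
Proof.
move=> bag0 ls s4 s17.
pose marked k (sg : nat -> nat) v := [exists j : 'I_N, (0 < j < k) && ((state (sg j)).2 v != 0)].
apply: (wp_for (L := 1) (H := N) (inv := fun k s' => [/\ imem s' 17 0 = 0,
   forall j, 0 < j -> j < k -> best (rmem s 1) j (imem s' 17 (par j)) (imem s' 17 j)
   & forall v : 'I_n, (imem s' 4 v != 0) = marked k (imem s' 17) v])) => //.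
- exact: (in_N (ready_in (listed_ready ls))).
- by apply: leq_trans (leq_subr _ _) NM.
- split=> //; first by case.
  by move=> v; rewrite s4; apply/esym/existsP => -[[[|j] jN]] /andP[].
- move=> k s1 k0 kN sm s20 [s1_0 best1 mark1]; have ls1 := listed_same sm isT isT ls.
  have s1_r : rmem s1 1 = rmem s 1 by rewrite (sm.2 1 isT).
  have pk := par_lt k0 kN; have pN := ltn_trans pk kN.
  apply: wp_seq; apply: wp_iset; set s2 := iwrite _ _ _ _.
  have ls2 : listed s2 by apply: listed_iwrite.
  pose f := imem s1 17 (par k).
  have s22 : imem s2 22 0 = f.
    by rewrite /= /write /= s20 (order_par (ready_ord (listed_ready ls1))).
  have stf : state_of (par k) f.
    rewrite /f; have [->|p0] := posnP (par k); first by rewrite s1_0 state_of00.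
    by have [] := best1 _ p0 pk.
  have s2_20 : imem s2 20 0 = k by [].
  have s2_17 : imem s2 17 = imem s1 17 by [].
  have s2_4 : imem s2 4 = imem s1 4 by [].
  have s2_r : rmem s2 1 = rmem s 1 by [].
  move: s2 ls2 s22 s2_20 s2_17 s2_4 s2_r => s2 ls2 s22 s2_20 s2_17 s2_4 s2_r.
  apply: wp_seq; apply: wp_use (wp_find_best ls2 k0 kN s2_20 s22 stf) _ => s3 sm3.
  set b := imem s3 16 0; rewrite s2_r => bestb; have ls3 := listed_same sm3 isT isT ls2.
  have bN : b < start N by have [/(state_of_ltN kN)] := bestb.
  apply: wp_seq; apply: wp_iset; set s4' := iwrite _ _ _ _.
  have ls4 : listed s4' by apply: listed_iwrite.
  have s4_17 i : imem s4' 17 i = if i == k then b else imem s1 17 i.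
    by rewrite /= /write /= (sm3.1 20 isT) s2_20 (sm3.1 17 isT) s2_17.
  have s4_4 i : imem s4' 4 i = imem s1 4 i by rewrite /= /write /= (sm3.1 4 isT) s2_4.
  have s4_16 : imem s4' 16 0 = b by [].
  move: s4' ls4 s4_17 s4_4 s4_16 => s5 ls5 s5_17 s5_4 s5_16.
  apply: (wp_for (L := 0) (H := n) (inv := fun y s' => forall v : 'I_n,
    (imem s' 4 v != 0) = (imem s1 4 v != 0) || (v < y) && ((state b).2 v != 0))) => //.
  + exact: (in_n (ready_in (listed_ready ls5))).
  + by rewrite subn0.
  + by move=> v; rewrite s5_4 orbF.
  + move=> y s6 _ yn sm6 s24 mark; have ls6 := listed_same sm6 isT isT ls5.
    pose y' := Ordinal yn.
    have testE : teval s6 (positive (color (var 16) (var 24))) = ((state b).2 y' != 0).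
      rewrite teval_positive /= (sm6.1 16 isT) s5_16 s24 -[y]/(nat_of_ord y').
      by rewrite (colorE _ ls6) // lt0n.
    have ltyS (v : 'I_n) : (v < y.+1) = (v == y') || (v < y).
      by rewrite ltnS leq_eqVlt -val_eqE.
    apply: wp_if; rewrite testE => test.
      apply: wp_iset => v; rewrite ltyS /= /write /= s24 -[y]/(nat_of_ord y') val_eqE.
      by case: (v =P y') => [->|_]; rewrite ?test ?orbT ?mark.
    apply: wp_skip => v; rewrite ltyS mark.
    by case: (v =P y') => [->|//]; rewrite (negbTE test) !andbF.
  move=> s6 sm6 mark; have s6_17 i : imem s6 17 i = if i == k then b else imem s1 17 i.
    by rewrite (sm6.1 17 isT).
  split.
  + by rewrite s6_17 ltn_eqF.
  + move=> j j0; rewrite ltnS leq_eqVlt => /orP[/eqP ->|jk].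
      by rewrite !s6_17 eqxx ltn_eqF.
    have pj := par_lt j0 (ltn_trans jk kN).
    by rewrite !s6_17 (ltn_eqF jk) (ltn_eqF (ltn_trans pj jk)); apply: best1.
  + move=> v; rewrite mark ltn_ord mark1 /=; apply/orP/existsP => [[/existsP[j]|vb]|[j]].
    * move=> /andP[/andP[j0 jk] vj]; exists j.
      by rewrite s6_17 (ltn_eqF jk) vj j0 ltnW.
    * by exists (Ordinal kN); rewrite s6_17 eqxx vb /= k0 ltnSn.
    * case/andP => /andP[j0]; rewrite s6_17 ltnS leq_eqVlt.
      case: eqP => [_ _ ?|_ /= jk vj]; [by right | left; apply/existsP; exists j].
      by rewrite j0 jk.
move=> s1 sm [s1_0 best1 mark1]; exists (imem s1 17); split=> //.
apply/setP => v; rewrite !inE mark1; apply/existsP/existsP => -[j].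
  by case/andP => _ vj; exists j.
move=> vj; exists j; rewrite vj ltn_ord !andbT lt0n.
apply: contraNneq vj => j0; rewrite j0 s1_0.
apply: contraT => v0.
have [vB _] := state_valid e_simple N_gt0 state_of00.
by have [] := vB v v0; rewrite bag0 inE.
Qed.

End Search.

Definition algorithm : prog :=
  Seq make_tables (Seq order_nodes (Seq list_states (Seq eliminate read_off))).

Lemma bit_matrixE (m n : nat) (f : 'I_m -> 'I_n -> bool) (x : 'I_m) (y : 'I_n) :
  bit_matrix f (x * n + y) = f x y.
Proof.
rewrite /bit_matrix; congr nat_of_bool; apply/existsP/idP => [[x' /existsP[y']]|fxy]; last first.
  by exists x; apply/existsP; exists y; rewrite eqxx.
have n0 : 0 < n by apply: leq_ltn_trans (ltn_ord y).
case/andP => /eqP E.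
have Ex : x = x'.
  by apply: val_inj; move: (congr1 (divn^~ n) E); rewrite !divnMDl // !divn_small // !addn0.
suff -> : y = y' by rewrite Ex.
by apply: val_inj; move/eqP: E; rewrite Ex eqn_add2l => /eqP.
Qed.

Lemma input_inputs (R : realType) (n N d : nat) (e : rel 'I_n) (w : 'I_n -> R)
    (tr : rel 'I_N) (r : 'I_N) (X : 'I_N -> {set 'I_n}) :
  inputs d e w tr r X (input d e w tr r X).
Proof. by split=> //= *; rewrite ?bit_matrixE // valK. Qed.

Lemma wp_algorithm (R : realType) (n N d M : nat) (e : rel 'I_n) (w : 'I_n -> R)
    (tr : rel 'I_N) (r : 'I_N) (X : 'I_N -> {set 'I_n}) :
  simple_graph e -> tree_decomposition e tr X -> X r = set0 ->
  n + N <= M -> d <= M ->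
  (forall t k, k <= n -> size (colorings d e (X t) k) <= M) ->
  wp M algorithm (input d e w tr r X)
    (fun s => max_weight_d_colorable d e w (output n s)).
Proof.
move=> e_simple dec Xr nNM dM few.
have nM := leq_trans (leq_addr _ _) nNM; have NM := leq_trans (leq_addl _ _) nNM.
have ins := input_inputs d e w tr r X; set s0 := input _ _ _ _ _ _ in ins *.
apply: wp_seq; apply: wp_use (wp_make_tables nNM ins _ _) _ => // s1 sm1 [ins1 tab1].
have tree := dec; case: tree => tree _ edge_bag _.
apply: wp_seq; apply: wp_use (wp_order_nodes NM tree ins1 tab1 _ _) _.
- by move=> x; rewrite (sm1.1 8 isT).
- by rewrite (sm1.1 9 isT).
move=> s2 sm2 [o [par [ord [o_inj o_surj [o0 par0] par_lt par_edge]]]].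
have N0 : 0 < N by apply: leq_ltn_trans (ltn_ord r).
pose bag j := X (o j).
have bag0 : bag 0 = set0 by rewrite /bag o0.
have rdy2 : ready d e w tr r X o par s2.
  split=> //; first exact: inputs_same sm2 isT isT ins1.
  by case: tab1 => t5 t6; split=> i iN; rewrite ?(sm2.1 5 isT) ?(sm2.1 6 isT) ?t5 ?t6.
have few_bag j k : k <= n -> size (colorings d e (bag j) k) <= M by apply: few.
have few_colorings j : size (bag_colorings d e bag j) <= M by apply: few_bag.
have H3 := wp_list_states e_simple par_lt par0 nM NM dM few_bag rdy2.
apply: wp_seq; apply: wp_use (H3 _ _) _.
- by rewrite (sm2.1 13 isT) (sm1.1 13 isT).
- by rewrite (sm2.1 14 isT) (sm1.1 14 isT).
move=> s3 sm3 [[rep13 rep14 rep11 rep1] s3_12].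
have rdy3 := ready_same sm3 isT isT rdy2.
have ls3 : listed d e w tr r X o par s3.
  by split=> // i iN; apply: rep14; apply: ltnW.
apply: wp_seq.
apply: wp_use (wp_eliminate e_simple N0 par_lt nM NM few_colorings ls3 (elim_inv_init rep1)) _.
move=> s4 sm4 inv; have ls4 := listed_same sm4 isT isT ls3.
apply: wp_use (wp_read_off e_simple N0 par_lt nM NM few_colorings bag0 ls4 _ _) _ => //.
- by move=> v; rewrite (sm4.1 4 isT) (sm3.1 4 isT) (sm2.1 4 isT) (sm1.1 4 isT).
- by rewrite (sm4.1 17 isT) (sm3.1 17 isT) (sm2.1 17 isT) (sm1.1 17 isT).
move=> s5 _ [sg [sg0 opt ->]].
apply: (elim_optimal e_simple N0 bag0 par_lt _ _ inv sg0 opt).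
- move=> u v uv; have [t [ut vt]] := edge_bag u v uv; have [j jN tE] := o_surj t.
  by exists j; rewrite /bag -tE.
- exact: (topmost dec o_inj o_surj par0 par_lt par_edge).
Qed.

Lemma time_bound_ge (R : realType) (n d k D c1 c2 : nat) :
  D ^ 2 <= 2 * k ->
  ((maxn n 2 ^ (c1 * d) * 2 ^ (D * d * c2))%:R <= time_bound R (c1 + 2 * c2) n d k)%R.
Proof.
move=> Dk; have b1 : (1 <= (maxn n 2)%:R :> R)%R by rewrite ler1n leq_max orbT.
rewrite natrM mulrC; apply: ler_pM; rewrite ?ler0n // !natrX.
  rewrite -powR_mulrn ?ler0n //; apply: ler_powR; first by rewrite ler1n.
  have Dle : (D%:R <= 2 * Num.sqrt k%:R :> R)%R.
    rewrite -(ler_pXn2r (n := 2)) ?nnegrE ?mulr_ge0 ?sqrtr_ge0 ?ler0n //.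
    rewrite exprMn sqr_sqrtr ?ler0n // -natrX -natrX -natrM ler_nat.
    by apply: leq_trans Dk _; rewrite leq_mul2r orbT.
  have m1 : (1 <= Num.max 1 (log2 d%:R) :> R)%R by rewrite le_max lexx.
  apply: (@le_trans _ _ (2 * c2%:R * (Num.sqrt k%:R * d%:R)))%R.
    rewrite !natrM -mulrA [X in (_ <= X)%R](_ : _ = 2 * Num.sqrt k%:R * (d%:R * c2%:R))%R.
      by rewrite ler_wpM2r // mulr_ge0 ?ler0n.
    by rewrite -!mulrA; congr (_ * _)%R; rewrite mulrC -mulrA.
  apply: ler_pM; rewrite ?mulr_ge0 ?ler0n ?sqrtr_ge0 //.
    by rewrite natrD natrM lerDr ler0n.
  by rewrite ler_wpM2l ?sqrtr_ge0 // ler_peMr ?ler0n.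
apply: ler_weXn2l => //.
by rewrite leq_mul2r leq_addr orbT.
Qed.

Theorem theorem3p6 :
  exists P : prog,
  forall a : nat,
  exists c : nat,
  forall (R : realType) (n N d k : nat)
         (e : rel 'I_n) (w : 'I_n -> R)
         (tr : rel 'I_N) (r : 'I_N) (X : 'I_N -> {set 'I_n}),
    1 <= d ->
    simple_graph e ->
    tree_decomposition e tr X ->
    nice tr r X ->
    almost_chordal k e X ->
    N <= maxn n 2 ^ a ->
    exists (t : nat) (s : memory R),
      [/\ exec P (input d e w tr r X) t s,
          max_weight_d_colorable d e w (output n s)
        & (t%:R <= time_bound R c n d k)%R].
Proof.
exists algorithm => a; have [K [p costP]] := cost_poly algorithm.
exists ((a + 2) * p + K + 2 * p) => R n N d k e w tr r X d0 e_simple dec [Xr _ _] Xk Nb.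
have [D D_le D_gt] : exists2 D, D ^ 2 <= 2 * k & 2 * k < D.+1 ^ 2.
  elim: (2 * k) => [|m [D Dm mD]]; first by exists 0.
  have [Em|Em] := eqVneq m.+1 (D.+1 ^ 2); first by exists D.+1; rewrite Em // ltn_exp2r.
  by exists D; [apply: leqW | rewrite ltn_neqAle Em].
set b := maxn n 2 in Nb; have b2 : 2 <= b by rewrite leq_max orbT.
have nb : n <= b by rewrite leq_max leqnn.
have b0 : 0 < b by apply: leq_trans b2.
pose M := b ^ ((a + 2) * d) * 2 ^ (D * d).
have le_M x : x <= (b ^ (a + 2) * 2 ^ D) ^ d -> x <= M by rewrite expnMn -!expnM.
have base1 : 0 < b ^ (a + 2) * 2 ^ D by rewrite muln_gt0 !expn_gt0 b0.
have nNM : n + N <= M.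
  apply: le_M; apply: leq_trans (_ : (b ^ (a + 2) * 2 ^ D) ^ 1 <= _); last first.
    by rewrite leq_pexp2l.
  rewrite expn1; apply: leq_trans (leq_pmulr _ _); rewrite ?expn_gt0 //.
  rewrite addn2 expnS; apply: leq_trans (leq_mul b2 (leqnn _)).
  rewrite mul2n -addnn leq_add //.
    apply: leq_trans nb _; rewrite expnS leq_pmulr // expn_gt0 b0 //.
  by apply: leq_trans Nb _; rewrite leq_pexp2l.
have dM : d <= M.
  apply: le_M; apply: leq_trans (ltnW (ltn_expl d (ltnSn 1))) _.
  rewrite leq_exp2r //; apply: leq_trans (leq_pmulr _ _); rewrite ?expn_gt0 //.
  by rewrite addn2 expnS; apply: leq_trans (leq_pmulr _ _); rewrite ?expn_gt0 ?b0.
have few t j : j <= n -> size (colorings d e (X t) j) <= M.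
  move=> jn; have kD : 2 * k < D.+1 * D.+2.
    by apply: leq_trans D_gt _; rewrite leq_mul.
  apply: le_M; apply: leq_trans (size_colorings d e_simple (Xk t) kD jn) _.
  rewrite leq_exp2r //; apply: leq_trans (_ : b ^ 2 * 2 ^ D <= _); last first.
    by rewrite leq_mul2r leq_pexp2l ?orbT // leq_addl.
  apply: leq_trans (_ : 2 ^ D + b * 2 ^ D <= _).
    by rewrite leq_add ?expn_gt0 // leq_mul2r nb orbT.
  rewrite -mulSn leq_mul2r; apply/orP; right.
  by apply: leq_trans (leq_mul b2 (leqnn b)); rewrite mul2n -addnn -add1n leq_add2r.
have [t [s [ex tM opt]]] := wp_algorithm w e_simple dec Xr nNM dM few.
exists t, s; split=> //.
apply: le_trans (time_bound_ge R n d ((a + 2) * p + K) p D_le).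
rewrite ler_nat -/b; apply: leq_trans tM _.
have M0 : 0 < M by rewrite muln_gt0 !expn_gt0 b0.
apply: leq_trans (costP M M0) _.
rewrite expnMn -!expnM mulnA (mulnDl _ K) expnD (mulnAC _ p) leq_mul2r.
apply/orP; right; rewrite mulnC leq_mul2l; apply/orP; right.
apply: leq_trans (ltnW (ltn_expl K b2)) _.
by rewrite leq_pexp2l // leq_pmulr.
Qed.
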